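(* Let $t\ge1$ be an integer, $N=(t+1)^2$, $\tau=\sqrt{\frac{2t+1}{4\pi}}\,(t+1)^3$, and let $\mathbb{Z}_N=\{[\mathbf{z}]_1,\ldots,[\mathbf{z}]_N\}$ be a set of spherical rectangles on $\mathbb{S}^2$ with cap-cover $\tilde{\mathbb{X}}_N=\{\mathcal{C}(\tilde{\mathbf{x}}_i,\gamma_i),\ i=1,\ldots,N\}$ and set of cap centers $\tilde X_N=\{\tilde{\mathbf{x}}_1,\ldots,\tilde{\mathbf{x}}_N\}$. Assume that (i) there exists a spherical $t$-design $X_N^0\in\tilde{\mathbb{X}}_N$, and (ii) $\mathbf{Y}(\tilde X_N)$ is nonsingular. Then any point set $X_N\in\mathbb{Z}_N$ is a fundamental (with order $t$) spherical $t_\epsilon$-design with $$\frac{2\tau\,\mathrm{rad}(\mathbb{Z}_N)\|\mathbf{Y}(\tilde X_N)^{-1}\|_1}{1-4\tau\,\mathrm{rad}(\mathbb{Z}_N)\|\mathbf{Y}(\tilde X_N)^{-1}\|_1}\le\epsilon<1,$$ if $$\mathrm{rad}(\mathbb{Z}_N)<\min\left(\frac14\rho(\mathbb{Z}_N),\ \frac{\epsilon}{2(1+2\epsilon)\tau\|\mathbf{Y}(\tilde X_N)^{-1}\|_1}\right).$$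
   Context: $\mathbb{S}^2$ is the unit sphere in $\mathbb{R}^3$ with surface measure $\mathrm{d}\omega$, $|\mathbb{S}^2|=4\pi$; the points of a point set are distinct. $\mathrm{dist}(\mathbf{x},\mathbf{y})=\cos^{-1}(\mathbf{x}\cdot\mathbf{y})$, and $\mathcal{C}(\mathbf{x},\gamma)=\{\mathbf{y}\in\mathbb{S}^2:\cos^{-1}(\mathbf{x}\cdot\mathbf{y})\le\gamma\}$. Write $S(\theta,\varphi)=(\sin\theta\cos\varphi,\sin\theta\sin\varphi,\cos\theta)^T$, with spherical coordinates $0\le\theta\le\pi$, $0\le\varphi<2\pi$. A spherical rectangle is $[\mathbf{z}]_i=\{S(\theta,\varphi):\theta\in[\underline{\theta}_i,\bar\theta_i],\ \varphi\in[\underline{\varphi}_i,\bar\varphi_i]\}$ with $[\underline{\theta}_i,\bar\theta_i]\subset[0,\pi]$, $[\underline{\varphi}_i,\bar\varphi_i]\subset[0,2\pi)$. Put $\mathbf{x}_{i,1}=S(\underline\theta_i,\underline\varphi_i)$, $\mathbf{x}_{i,3}=S(\bar\theta_i,\bar\varphi_i)$ (two of its vertices), $\tilde{\mathbf{x}}_i=S\big(\tfrac12(\underline\theta_i+\bar\theta_i),\tfrac12(\underline\varphi_i+\bar\varphi_i)\big)$ and $\gamma_i=\max\{\mathrm{dist}(\tilde{\mathbf{x}}_i,\mathbf{x}_{i,1}),\mathrm{dist}(\tilde{\mathbf{x}}_i,\mathbf{x}_{i,3})\}$. The cap-cover of $\mathbb{Z}_N=\{[\mathbf{z}]_1,\ldots,[\mathbf{z}]_N\}$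 is $\tilde{\mathbb{X}}_N=\{\mathcal{C}(\tilde{\mathbf{x}}_i,\gamma_i)\}_{i=1}^N$. Define $\mathrm{rad}(\mathbb{Z}_N)=\max_{1\le i\le N}\gamma_i$ and $\rho(\mathbb{Z}_N)=\min_{i\ne j}\{\mathrm{dist}(\tilde{\mathbf{x}}_i,\tilde{\mathbf{x}}_j)-\gamma_i-\gamma_j\}$. For a family $\{A_1,\ldots,A_N\}$ of subsets of $\mathbb{S}^2$ (either $\mathbb{Z}_N$ or $\tilde{\mathbb{X}}_N$) and a point set $X_N=\{\mathbf{x}_1,\ldots,\mathbf{x}_N\}$, $X_N\in\{A_1,\ldots,A_N\}$ means $\mathbf{x}_i\in A_i$ and $\mathbf{x}_i\notin A_j$ for all $i$ and all $j\ne i$. A spherical polynomial of degree $\le t$ is the restriction to $\mathbb{S}^2$ of a real polynomial in three variables of degree $\le t$; their space is $\mathbb{P}_t$, of dimension $(t+1)^2$. A set $X_N=\{\mathbf{x}_1,\ldots,\mathbf{x}_N\}\subset\mathbb{S}^2$ is a spherical $t$-design if $\frac1N\sum_{j=1}^N p(\mathbf{x}_j)=\frac1{4\pi}\int_{\mathbb{S}^2}p\,\mathrm{d}\omega$ for all $p\in\mathbb{P}_t$. For $0\le\epsilon<1$, it is a spherical $t_\epsilon$-design if there are weights $\mathbf{w}=(w_1,\ldots,w_N)^T$ with $\frac{4\pi}{N}(1-\epsilon)\le w_i\le\frac{4\pi}{N}(1-\epsilon)^{-1}$ for $i=1,\ldots,N$, such that $\sum_{i=1}^N w_i p(\mathbf{x}_i)=\int_{\mathbb{S}^2}p\,\mathrm{d}\omega$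 for all $p\in\mathbb{P}_t$. $X_N$ is fundamental with order $t$ if the zero polynomial is the only element of $\mathbb{P}_t$ vanishing at every point of $X_N$. $\{Y_{\ell,k}:\ell\ge0,\ k=1,\ldots,2\ell+1\}$ is a fixed real spherical harmonic basis ($Y_{\ell,k}$ of degree $\ell$), orthonormal in $\mathbb{L}_2(\mathbb{S}^2)$. $\mathbf{Y}(X_N)\in\mathbb{R}^{N\times(t+1)^2}$ has entries $\mathbf{Y}_{i,\ell^2+k}(X_N)=Y_{\ell,k}(\mathbf{x}_i)$, $i=1,\ldots,N$, $k=1,\ldots,2\ell+1$, $\ell=0,\ldots,t$; it is square since $N=(t+1)^2$. The matrix norm $\|\cdot\|_1$ is the maximum absolute column sum. *)

(* Defs.v *)
From HB Require Import structures.
From mathcomp Require Import all_boot all_order all_algebra.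
From mathcomp Require Import all_classical all_reals all_analysis.
From mathcomp Require mpoly.
(* The notations of mpoly clash with those of the analysis library. *)
Import (coercions, canonicals) mpoly.
From Stdlib Require PeanoNat.
From mathcomp Require Import zify.

Set Implicit Arguments.
Unset Strict Implicit.
Unset Printing Implicit Defensive.

Import Order.TTheory GRing.Theory Num.Theory.

Local Open Scope classical_set_scope.
Local Open Scope ring_scope.

Section Geometry.
Context {R : realType}.
Implicit Types x y : 'cV[R]_3.

Definition dot3 x y : R := \sum_(i < 3) x i 0 * y i 0.

Definition sphere : set 'cV[R]_3 := [set x | Num.sqrt (dot3 x x) = 1].

Definition sdist x y : R := acos (dot3 x y).

Definition cap x (g : R) : set 'cV[R]_3 := [set y | sphere y /\ sdist x y <= g].

Definition spoint (theta phi : R) : 'cV[R]_3 :=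
  \col_(i < 3) [:: sin theta * cos phi; sin theta * sin phi; cos theta]`_i.

(* Integration against the surface measure sin(theta) dtheta dphi. *)
Definition sphere_int (f : 'cV[R]_3 -> R) : R :=
  Rintegral lebesgue_measure `[0, pi] (fun theta =>
    Rintegral lebesgue_measure `[0, 2 * pi[ (fun phi =>
      f (spoint theta phi) * sin theta)).

End Geometry.

(* A spherical rectangle, kept together with its coordinate bounds, since the
   centre and the vertices are functions of the bounds. *)
Record srect (R : realType) := SRect {
  th_lo : R; th_hi : R; ph_lo : R; ph_hi : R;
  th_bounds : [/\ 0 <= th_lo, th_lo <= th_hi & th_hi <= pi];
  ph_bounds : [/\ 0 <= ph_lo, ph_lo <= ph_hi & ph_hi < 2 * pi] }.

Section Rectangles.
Context {R : realType}.
Implicit Type z : srect R.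

Definition rect_set z : set 'cV[R]_3 :=
  [set x | exists theta phi,
     [/\ th_lo z <= theta <= th_hi z, ph_lo z <= phi <= ph_hi z &
         x = spoint theta phi]].

Definition vertex1 z := spoint (th_lo z) (ph_lo z).
Definition vertex3 z := spoint (th_hi z) (ph_hi z).
Definition rect_center z :=
  spoint ((th_lo z + th_hi z) / 2) ((ph_lo z + ph_hi z) / 2).

Definition rect_radius z : R :=
  Num.max (sdist (rect_center z) (vertex1 z)) (sdist (rect_center z) (vertex3 z)).

Definition rect_cap z : set 'cV[R]_3 := cap (rect_center z) (rect_radius z).

(* The radii are nonnegative, so the default value 0 does not affect the
   maximum when N > 0. *)
Definition Zrad N (Z : 'I_N -> srect R) : R :=
  \big[Num.max/0]_(i < N) rect_radius (Z i).

(* Each term is at most pi (dist <= pi, radii >= 0), so the default value pi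
   does not affect the minimum when N > 1. *)
Definition Zrho N (Z : 'I_N -> srect R) : R :=
  \big[Num.min/pi]_(p : 'I_N * 'I_N | p.1 != p.2)
    (sdist (rect_center (Z p.1)) (rect_center (Z p.2))
       - rect_radius (Z p.1) - rect_radius (Z p.2)).

End Rectangles.

Section PointSets.
Context {R : realType}.

Definition point_set N (X : 'I_N -> 'cV[R]_3) :=
  injective X /\ forall i, sphere (X i).

Definition in_family N (X : 'I_N -> 'cV[R]_3) (A : 'I_N -> set 'cV[R]_3) :=
  forall i, A i (X i) /\ forall j, j != i -> ~ A j (X i).

Definition restricts_to (f : 'cV[R]_3 -> R) (p : mpoly.mpoly 3 R) :=
  forall x, sphere x -> f x = mpoly.meval (fun i => x i 0) p.

(* msize is the total degree plus one, and 0 on the zero polynomial.  Only the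
   values of f on the sphere matter. *)
Definition sph_poly t (f : 'cV[R]_3 -> R) :=
  exists2 p : mpoly.mpoly 3 R,
    (mpoly.msize p <= t.+1)%N & restricts_to f p.

Definition t_design t N (X : 'I_N -> 'cV[R]_3) :=
  point_set X /\ forall p, sph_poly t p ->
    N%:R^-1 * \sum_(j < N) p (X j) = (4 * pi)^-1 * sphere_int p.

Definition t_eps_design t (eps : R) N (X : 'I_N -> 'cV[R]_3) :=
  point_set X /\ exists w : 'cV[R]_N,
    (forall i, 4 * pi / N%:R * (1 - eps) <= w i 0
                 <= 4 * pi / N%:R * (1 - eps)^-1) /\
    (forall p, sph_poly t p -> \sum_(i < N) w i 0 * p (X i) = sphere_int p).

Definition fundamental t N (X : 'I_N -> 'cV[R]_3) :=
  forall p, sph_poly t p -> (forall i, p (X i) = 0) ->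
    forall x, sphere x -> p x = 0.

End PointSets.

Section Harmonics.
Context {R : realType}.

Definition laplacian (p : mpoly.mpoly 3 R) : mpoly.mpoly 3 R :=
  \sum_(i < 3) mpoly.mderiv i (mpoly.mderiv i p).

Definition spherical_harmonic l (f : 'cV[R]_3 -> R) :=
  exists p : mpoly.mpoly 3 R,
    [/\ p \is mpoly.ishomog1 l mpoly.mdeg, laplacian p = 0 & restricts_to f p].

(* The order k of Y_{l,k} ranges over 0, ..., 2l instead of 1, ..., 2l + 1. *)
Definition harmonic_basis (Y : forall l : nat, 'I_(2 * l).+1 -> 'cV[R]_3 -> R) :=
  (forall l k, spherical_harmonic l (Y l k)) /\
  (forall l k l' k', sphere_int (fun x => Y l k x * Y l' k' x) =
                     ((l == l') && (k == k' :> nat))%:R).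

(* Column j (from 0) is j = l ^ 2 + k with 0 <= k <= 2l, so that l is the
   integer part of the square root of j; see Ymx_entry. *)
Definition Ymx (Y : forall l : nat, 'I_(2 * l).+1 -> 'cV[R]_3 -> R)
    t N (X : 'I_N -> 'cV[R]_3) : 'M[R]_(N, t.+1 ^ 2) :=
  \matrix_(i < N, j < t.+1 ^ 2)
    Y (Nat.sqrt j) (inord (j - Nat.sqrt j ^ 2)) (X i).

Lemma Ymx_entry Y t N X (i : 'I_N) l (k : 'I_(2 * l).+1) (j : 'I_(t.+1 ^ 2)) :
  j = (l ^ 2 + k)%N :> nat -> Ymx Y t X i j = Y l k (X i).
Proof.
move=> jE; rewrite mxE.
have -> : Nat.sqrt j = l.
  apply: PeanoNat.Nat.sqrt_unique; have := ltn_ord k.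
  by rewrite jE -mulnn; lia.
by rewrite jE addKn inord_val.
Qed.

Definition mxnorm1 m n (A : 'M[R]_(m, n)) : R :=
  \big[Num.max/0]_(j < n) \sum_(i < m) `|A i j|.

End Harmonics.

(* Main.v *)
Require Import Defs.
From mathcomp Require Import all_boot all_order all_algebra.
From mathcomp Require Import all_classical all_reals all_analysis.
From mathcomp Require Import ring lra zify.
Import -(notations) mpoly.
Import Order.TTheory GRing.Theory Num.Theory.
Import numFieldNormedType.Exports.

Set Implicit Arguments.
Unset Strict Implicit.
Unset Printing Implicit Defensive.

Local Open Scope classical_set_scope.
Local Open Scope ring_scope.

(** Write Y(X) for the matrix of the values of the harmonics of degree at most t
    at the points X.  All of X, X0 and the centres lie in the same caps (a
    rectangle of radius less than pi / 2 is contained in its cap,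
    [rect_set_sub_cap]), so Y(X) and Y(X0) are small perturbations of the
    invertible matrix of the centres.  Equal weights at X0 integrate exactly; the
    weights at X that reproduce the same sums exist because Y(X) is still
    invertible, and they differ from the equal weights by the solution of a
    perturbed linear system ([perturbed_solution_le]).  They integrate every
    spherical polynomial, because the (t + 1) ^ 2 harmonics span these
    polynomials on the sphere ([harmonics_span]); the same spanning makes X
    fundamental.

    The perturbation is controlled by a Lipschitz bound: an L2-normalised
    harmonic of degree l satisfies
      (q(x) - q(y)) ^ 2 <= (2l + 1) / (4 pi) * l (l + 1) * (1 - x . y)
    ([harmonic_lipschitz_dot]).  The value q(x) is the inner product of q with
    the zonal harmonic Z_x, up to the factor (2l + 1) / (4 pi)
    ([zonal_reproducing]), so by Cauchy-Schwarz the bound reduces to the norm of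
    Z_x - Z_y, that is, to the estimate 1 - P_l(c) <= l (l + 1) / 2 * (1 - c) for
    Legendre polynomials ([peval_zonal_ge]).

    None of this uses rotations of the sphere.  The zonal harmonics are defined by
    the Legendre recursion as polynomials with an arbitrary pole, and their
    properties rest on one identity for the integral, the divergence theorem
    ([sphere_integral_divergence]), which is checked on monomials by integrating
    products of powers of sines and cosines.  It yields the orthogonality of
    different degrees ([harmonic_orthogonal]), and the reproducing property follows
    by induction on the degree. *)

(** * Differential operators on polynomials in three variables *)

Section DifferentialOperators.
Context {R : realType}.
Local Notation poly3 := (mpoly 3 R).
Local Notation "''Y_' i" := (mpolyX R (mnm1 i))
  (at level 8, i at level 2, format "''Y_' i").
Local Notation C := (@mpolyC 3 R).
Implicit Types (p q : poly3) (x : 'cV[R]_3) (c : R).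

Definition euler p : poly3 := \sum_(i < 3) 'Y_i * mderiv i p.
Definition grad_dot p q : poly3 := \sum_(i < 3) mderiv i p * mderiv i q.
Definition dir_deriv x p : poly3 := \sum_(i < 3) C (x i 0) * mderiv i p.
Definition linear_form x : poly3 := \sum_(i < 3) C (x i 0) * 'Y_i.
Definition sq_norm : poly3 := \sum_(i < 3) 'Y_i * 'Y_i.

Let big3 (F : 'I_3 -> poly3) :
  \sum_(i < 3) F i = F 0 + F (lift ord0 0) + F (lift ord0 (lift ord0 0)).
Proof. by rewrite !big_ord_recl big_ord0 addr0 addrA. Qed.

Lemma mderivXU (i j : 'I_3) : mderiv j 'Y_i = (i == j)%:R.
Proof.
rewrite mderivX mnm1E; case: eqP => [->|_]; last by rewrite scale0r.
rewrite scale1r (_ : mnm_sub _ _ = mnm0) ?mpolyX0 //.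
by apply/mnmP => k; rewrite mnmBE subnn mnm0E.
Qed.

Lemma mderivCM i c p : mderiv i (C c * p) = C c * mderiv i p.
Proof. exact: mderiv_mulC. Qed.

Lemma mderiv_sum3 i (F : 'I_3 -> poly3) :
  mderiv i (\sum_(j < 3) F j) = \sum_(j < 3) mderiv i (F j).
Proof. exact: (raddf_sum (mderiv i)). Qed.

Lemma eulerM p q : euler (p * q) = euler p * q + p * euler q.
Proof. by rewrite /euler !big3 !mderivM; ring. Qed.

Lemma eulerD p q : euler (p + q) = euler p + euler q.
Proof. by rewrite /euler !big3 !mderivD; ring. Qed.

Lemma eulerCM c p : euler (C c * p) = C c * euler p.
Proof. rewrite /euler !big3 !mderivCM. ring. Qed.

Lemma laplacianD p q : laplacian (p + q) = laplacian p + laplacian q.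
Proof. by rewrite /laplacian !big3 !mderivD; ring. Qed.

Lemma laplacianCM c p : laplacian (C c * p) = C c * laplacian p.
Proof. by rewrite /laplacian !big3 !mderivCM; ring. Qed.

Lemma laplacianM p q :
  laplacian (p * q) = laplacian p * q + 2 * grad_dot p q + p * laplacian q.
Proof. by rewrite /laplacian /grad_dot !big3 !(mderivM, mderivD); ring. Qed.

Lemma dir_derivM x p q :
  dir_deriv x (p * q) = dir_deriv x p * q + p * dir_deriv x q.
Proof. by rewrite /dir_deriv !big3 !mderivM; ring. Qed.

Lemma dir_derivD x p q : dir_deriv x (p + q) = dir_deriv x p + dir_deriv x q.
Proof. by rewrite /dir_deriv !big3 !mderivD; ring. Qed.

Lemma dir_derivCM x c p : dir_deriv x (C c * p) = C c * dir_deriv x p.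
Proof. by rewrite /dir_deriv !big3 !mderivCM; ring. Qed.

Lemma mderiv_linear_form i x : mderiv i (linear_form x) = C (x i 0).
Proof.
rewrite /linear_form mderiv_sum3 (bigD1 i) //= big1 => [|j ji].
  by rewrite mderivCM mderivXU eqxx mulr1 addr0.
by rewrite mderivCM mderivXU (negbTE ji) mulr0.
Qed.

Lemma mderiv_sq_norm i : mderiv i sq_norm = 2 * 'Y_i.
Proof.
rewrite /sq_norm mderiv_sum3 (bigD1 i) //= big1 => [|j ji].
  by rewrite mderivM mderivXU eqxx mulr1n; ring.
by rewrite mderivM mderivXU (negbTE ji) mulr0n; ring.
Qed.

Lemma euler_linear_form x : euler (linear_form x) = linear_form x.
Proof.
by apply: eq_bigr => i _; rewrite mderiv_linear_form mulrC.
Qed.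

Lemma euler_sq_norm : euler sq_norm = 2 * sq_norm.
Proof.
rewrite /euler /sq_norm mulr_sumr.
by apply: eq_bigr => i _; rewrite mderiv_sq_norm; ring.
Qed.

Lemma dir_deriv_linear_form x :
  dir_deriv x (linear_form x) = C (dot3 x x).
Proof.
rewrite /dot3 rmorph_sum; apply: eq_bigr => i _.
by rewrite mderiv_linear_form rmorphM.
Qed.

Lemma dir_deriv_sq_norm x : dir_deriv x sq_norm = 2 * linear_form x.
Proof.
rewrite /dir_deriv /linear_form mulr_sumr.
by apply: eq_bigr => i _; rewrite mderiv_sq_norm; ring.
Qed.

Lemma laplacian_linear_form x : laplacian (linear_form x) = 0.
Proof.
by apply: big1 => i _; rewrite mderiv_linear_form mderivC.
Qed.

Lemma laplacian_sq_norm : laplacian sq_norm = 6.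
Proof.
have c2 : 2 = C 2 by rewrite rmorph_nat.
rewrite /laplacian big3 !mderiv_sq_norm c2 !mderivCM !mderivXU !eqxx -c2 mulr1n.
by ring.
Qed.

Lemma grad_dot_linear_form x p : grad_dot (linear_form x) p = dir_deriv x p.
Proof. by apply: eq_bigr => i _; rewrite mderiv_linear_form. Qed.

Lemma grad_dot_sq_norm p : grad_dot sq_norm p = 2 * euler p.
Proof.
rewrite /euler mulr_sumr.
by apply: eq_bigr => i _; rewrite mderiv_sq_norm; ring.
Qed.

Lemma grad_dotC p q : grad_dot p q = grad_dot q p.
Proof. by apply: eq_bigr => i _; rewrite mulrC. Qed.

Lemma mderiv_euler i p : mderiv i (euler p) = euler (mderiv i p) + mderiv i p.
Proof.
rewrite /euler mderiv_sum3.
under eq_bigr do rewrite mderivM mderivXU mderiv_comm.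
rewrite big_split /= addrC; congr (_ + _).
rewrite (bigD1 i) //= eqxx mul1r big1 ?addr0 // => j ji.
by rewrite (negbTE ji) mul0r.
Qed.

Lemma laplacian_dir_deriv x p :
  laplacian (dir_deriv x p) = dir_deriv x (laplacian p).
Proof.
rewrite /dir_deriv /laplacian.
under eq_bigr do rewrite !mderiv_sum3.
rewrite exchange_big; apply: eq_bigr => j _.
rewrite mderiv_sum3 [RHS]mulr_sumr; apply: eq_bigr => i _.
by rewrite /= !mderivCM (mderiv_comm j i) (mderiv_comm j i).
Qed.

(** Homogeneity through Euler's identity, which is equivalent to it in
    characteristic 0 and composes with the differential operators. *)
Definition homogeneous l p := euler p = l%:R * p.
Definition harmonic l p := homogeneous l p /\ laplacian p = 0.

Lemma homogeneous_mderiv l i p :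
  homogeneous l.+1 p -> homogeneous l (mderiv i p).
Proof.
move=> hp; have := mderiv_euler i p; rewrite hp.
rewrite -(rmorph_nat (@mpolyC 3 R)) mderivCM rmorph_nat /homogeneous.
by rewrite -natr1 => h; apply: (addIr (mderiv i p)); rewrite -h; ring.
Qed.

Lemma homogeneous_sum l (I : finType) (F : I -> poly3) :
  (forall i, homogeneous l (F i)) -> homogeneous l (\sum_i F i).
Proof.
move=> hF; rewrite /homogeneous mulr_sumr.
elim/big_rec2: _ => [|i p q _ <-]; last by rewrite eulerD hF.
by rewrite /euler big1 // => i _; rewrite mderiv0 mulr0.
Qed.

Lemma homogeneousCM l c p : homogeneous l p -> homogeneous l (C c * p).
Proof. by rewrite /homogeneous eulerCM => ->; ring. Qed.

Lemma homogeneousD l p q :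
  homogeneous l p -> homogeneous l q -> homogeneous l (p + q).
Proof. by rewrite /homogeneous eulerD => -> ->; ring. Qed.

Lemma homogeneousM a b p q :
  homogeneous a p -> homogeneous b q -> homogeneous (a + b) (p * q).
Proof. by rewrite /homogeneous eulerM natrD => -> ->; ring. Qed.

Lemma homogeneous_linear_form x : homogeneous 1 (linear_form x).
Proof. by rewrite /homogeneous mul1r euler_linear_form. Qed.

Lemma homogeneous_sq_norm : homogeneous 2 sq_norm.
Proof. exact: euler_sq_norm. Qed.

Lemma homogeneous_dir_deriv l x p :
  homogeneous l.+1 p -> homogeneous l (dir_deriv x p).
Proof.
by move=> hp; apply: homogeneous_sum => i; apply/homogeneousCM/homogeneous_mderiv.
Qed.

Lemma harmonic_dir_deriv l x p :
  harmonic l.+1 p -> harmonic l (dir_deriv x p).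
Proof.
move=> [hp lp]; split; first exact: homogeneous_dir_deriv.
rewrite laplacian_dir_deriv lp /dir_deriv big1 // => i _.
by rewrite mderiv0 mulr0.
Qed.

Lemma laplacian_sq_normM l p :
  harmonic l p -> laplacian (sq_norm * p) = (4 * l%:R + 6) * p.
Proof.
move=> [hp lp].
rewrite laplacianM laplacian_sq_norm grad_dot_sq_norm hp lp.
ring.
Qed.

Lemma laplacian_linear_formM x l p :
  harmonic l p -> laplacian (linear_form x * p) = 2 * dir_deriv x p.
Proof.
move=> [hp lp].
by rewrite laplacianM laplacian_linear_form grad_dot_linear_form lp; ring.
Qed.

(** The Laplacian of the product of a linear form and a solid harmonic is twice
    a directional derivative, hence also the Laplacian of a multiple of the
    squared norm.  Subtracting that multiple splits the product, on the sphere,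
    into harmonics of degrees l + 2 and l. *)
Lemma linear_form_decomp x l p : harmonic l.+1 p ->
  harmonic l.+2 (linear_form x * p +
                 C (- (2 * l.+1%:R + 1)^-1) * (sq_norm * dir_deriv x p)).
Proof.
move=> hp; have hd := harmonic_dir_deriv x hp; split.
  apply: homogeneousD; last apply: homogeneousCM.
    exact: (homogeneousM (homogeneous_linear_form x) hp.1).
  exact: (homogeneousM homogeneous_sq_norm hd.1).
rewrite laplacianD laplacianCM (laplacian_linear_formM x hp).
rewrite (laplacian_sq_normM hd).
have -> : 4 * l%:R + 6 = C (2 * (2 * l.+1%:R + 1)).
  rewrite !(rmorphM, rmorphD, rmorph1, rmorph_nat) -natr1; ring.
rewrite mulrA -mpolyCM.
have nz : 2 * l.+1%:R + 1 != 0 :> R by rewrite -natrM natr1 pnatr_eq0.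
rewrite [_ * (2 * _)](_ : _ = - 2); last by field.
rewrite rmorphN rmorph_nat; ring.
Qed.

End DifferentialOperators.

(** * Integrals of powers of sine and cosine *)

Section RealIntegrals.
Context {R : realType}.
Local Notation mu := (@lebesgue_measure R).

Lemma Rintegral_FTC (f F : R -> R) (a b : R) : a < b -> continuous f ->
  (forall x : R, is_derive x (1 : R) F (f x)) ->
  \int[mu]_(x in `[a, b]) f x = F b - F a.
Proof.
move=> ab cf dF; rewrite /Rintegral (continuous_FTC2 (F := F) ab) //.
- exact: continuous_subspaceT.
- have cF : continuous F.
    move=> x; apply: differentiable_continuous.
    by apply/derivable1_diffP; case: (dF x).
  split; first by move=> x _; case: (dF x).
  + exact: cvg_at_right_filter (cF a).
  + exact: cvg_at_left_filter (cF b).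
- by move=> x _; rewrite derive1E; case: (dF x).
Qed.

Lemma continuous_integrable (f : R -> R) (a b : R) (bl br : bool) :
  continuous f ->
  mu.-integrable [set` Interval (BSide bl a) (BSide br b)] (EFin \o f).
Proof.
move=> cf; have h := @integrableS _ _ _ mu `[a, b]%classic
  [set` Interval (BSide bl a) (BSide br b)] (EFin \o f).
apply: h; [exact: measurable_itv | exact: measurable_itv | |].
- apply: subset_itv; first by case: bl; rewrite bnd_simp.
  by case: br; rewrite bnd_simp.
apply: continuous_compact_integrable; first exact: segment_compact.
exact: continuous_subspaceT.
Qed.

Lemma Rintegral_lincomb (I : finType) (c : I -> R) (f : I -> R -> R)
    (D : set R) : measurable D ->
  (forall i, mu.-integrable D (EFin \o f i)) ->
  \int[mu]_(x in D) (\sum_i c i * f i x) = \sum_i c i * \int[mu]_(x in D) f i x.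
Proof.
move=> mD fi; have cfi i : mu.-integrable D (EFin \o (fun x => c i * f i x)).
  rewrite (_ : _ \o _ = fun x => ((c i)%:E * (f i x)%:E)%E); last first.
    by apply/funext => x; rewrite /= EFinM.
  have h := @integrableZl _ _ _ mu D mD (c i) _ (fi i); exact: h.
have sumI (r : seq I) :
    mu.-integrable D (EFin \o (fun x => \sum_(i <- r) c i * f i x)).
  have h := @integrable_sum _ _ _ mu D mD I r xpredT _ (fun i _ => cfi i).
  rewrite (_ : _ \o _ = fun x => \sum_(i <- r) (c i * f i x)%:E)%E //.
  by apply/funext => x /=; rewrite sumEFin.
elim: (index_enum I) => [|i r IH].
  under [LHS]eq_Rintegral do rewrite big_nil.
  by rewrite Rintegral_cst // mul0r big_nil.
under [LHS]eq_Rintegral do rewrite big_cons.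
by rewrite RintegralD // RintegralZl // IH big_cons.
Qed.

Definition sincos_int L n c : R :=
  \int[mu]_(x in `[0, L]) (sin x ^+ n * cos x ^+ c).

Lemma continuous_sincos n c : continuous (fun x : R => sin x ^+ n * cos x ^+ c).
Proof.
move=> x; apply: cvgM.
  by apply: (@continuous_comp _ _ _ sin (fun y => y ^+ n));
    [exact: continuous_sin | exact: exprn_continuous].
by apply: (@continuous_comp _ _ _ cos (fun y => y ^+ c));
    [exact: continuous_cos | exact: exprn_continuous].
Qed.

Lemma integrable_sincos L n c :
  mu.-integrable `[0, L] (EFin \o (fun x : R => sin x ^+ n * cos x ^+ c)).
Proof. exact: (continuous_integrable 0 L true false (@continuous_sincos n c)). Qed.

Lemma is_derive_sincos n c (x : R) :
  is_derive x 1 (fun x : R => sin x ^+ n * cos x ^+ c)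
    (n%:R * sin x ^+ n.-1 * cos x ^+ c.+1 - c%:R * sin x ^+ n.+1 * cos x ^+ c.-1).
Proof.
have -> : (fun x : R => sin x ^+ n * cos x ^+ c) = sin ^+ n * cos ^+ c.
  by apply/funext => y; rewrite !fctE.
apply: (is_derive_eq (is_deriveM (is_deriveX n (is_derive_sin x))
  (is_deriveX c (is_derive_cos x)))).
by rewrite !fctE /GRing.scale /= !exprS; ring.
Qed.

Section Recursion.
Variable L : R.
Hypotheses (L_gt0 : 0 < L) (sinL : sin L = 0).

(** The derivative of sin ^ (n + 1) * cos ^ (c + 1) integrates to 0, since the
    sine vanishes at both ends. *)
Lemma sincos_parts n c :
  n.+1%:R * sincos_int L n c.+2 = c.+1%:R * sincos_int L n.+2 c.
Proof.
apply/eqP; rewrite -subr_eq0; apply/eqP.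
pose f (b : bool) x := (if b then sin x ^+ n * cos x ^+ c.+2
                       else sin x ^+ n.+2 * cos x ^+ c) : R.
have cf b : continuous (f b) by case: b; exact: continuous_sincos.
have := @Rintegral_lincomb bool (fun b => if b then n.+1%:R else - c.+1%:R) f
  `[0, L] (measurable_itv _) (fun b => continuous_integrable 0 L true false (cf b)).
rewrite big_bool /= mulNr => <-.
have cg : continuous (fun x =>
    \sum_(b : bool) (if b then n.+1%:R else - c.+1%:R) * f b x).
  rewrite (_ : (fun x => _) = fun x =>
      n.+1%:R * f true x + - c.+1%:R * f false x); last first.
    by apply/funext => x; rewrite big_bool.
  move=> x; apply: cvgD; apply: cvgM;
    by [exact: cvg_cst | exact: (cf true) | exact: (cf false)].
rewrite (Rintegral_FTC L_gt0 cg (F := fun x : R => sin x ^+ n.+1 * cos x ^+ c.+1)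
   (fun x => is_derive_eq (is_derive_sincos _ _ _) _)).
  by rewrite sinL sin0 !expr0n /= !mul0r subrr.
by move=> x; rewrite big_bool /= mulNr !mulrA.
Qed.

Lemma sincos_split n c :
  sincos_int L n c = sincos_int L n c.+2 + sincos_int L n.+2 c.
Proof.
rewrite /sincos_int -RintegralD //;
  try exact: integrable_sincos.
apply: eq_Rintegral => x _.
have := cos2Dsin2 x; rewrite !exprS => /= h.
rewrite -[LHS]mulr1 -h; ring.
Qed.

Lemma sincos_intSS_cos n c :
  (n + c + 2)%:R * sincos_int L n c.+2 = c.+1%:R * sincos_int L n c.
Proof.
rewrite (sincos_split n c) mulrDr -sincos_parts -mulrDl; congr (_ * _).
by rewrite -natrD; congr (_%:R); lia.
Qed.

Lemma sincos_intSS_sin n c :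
  (n + c + 2)%:R * sincos_int L n.+2 c = n.+1%:R * sincos_int L n c.
Proof.
rewrite (sincos_split n c) mulrDr sincos_parts -mulrDl; congr (_ * _).
by rewrite -natrD; congr (_%:R); lia.
Qed.

Lemma sincos_int_cos1 n : sincos_int L n 1 = 0.
Proof.
have : n.+1%:R * sincos_int L n 1 = 0.
  rewrite /sincos_int -RintegralZl //; last exact: integrable_sincos.
  have cg : continuous (fun x : R => n.+1%:R * (sin x ^+ n * cos x ^+ 1)).
    by move=> x; apply: cvgM; [exact: cvg_cst | exact: continuous_sincos].
  rewrite (Rintegral_FTC L_gt0 cg (F := fun x : R => sin x ^+ n.+1 * cos x ^+ 0)
    (fun x => is_derive_eq (is_derive_sincos _ _ _) _)).
    by rewrite sinL sin0 !expr0n /= !mul0r subrr.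
  by move=> x /=; ring.
by move/eqP; rewrite mulf_eq0 pnatr_eq0 /= => /eqP.
Qed.

Lemma sincos_int_sin1 c : cos L = 1 -> sincos_int L 1 c = 0.
Proof.
move=> cosL; have : - c.+1%:R * sincos_int L 1 c = 0.
  rewrite /sincos_int -RintegralZl //; last exact: integrable_sincos.
  have cg : continuous (fun x : R => - c.+1%:R * (sin x ^+ 1 * cos x ^+ c)).
    by move=> x; apply: cvgM; [exact: cvg_cst | exact: continuous_sincos].
  rewrite (Rintegral_FTC L_gt0 cg (F := fun x : R => sin x ^+ 0 * cos x ^+ c.+1)
    (fun x => is_derive_eq (is_derive_sincos _ _ _) _)).
    by rewrite cosL cos0 !expr1n subrr.
  by move=> x /=; ring.
by move/eqP; rewrite mulf_eq0 oppr_eq0 pnatr_eq0 /= => /eqP.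
Qed.

End Recursion.
End RealIntegrals.

(** * Integration of polynomials over the sphere *)

Section SphereIntegral.
Context {R : realType}.
Local Notation poly3 := (mpoly 3 R).
Local Notation "''Y_' i" := (mpolyX R (mnm1 i))
  (at level 8, i at level 2, format "''Y_' i").
Local Notation C := (@mpolyC 3 R).
Local Notation mu := (@lebesgue_measure R).
Local Notation i0 := (ord0 : 'I_3).
Local Notation i1 := (lift ord0 ord0 : 'I_3).
Local Notation i2 := (lift ord0 (lift ord0 ord0) : 'I_3).
Implicit Types (p q : poly3) (x y : 'cV[R]_3).

Definition peval p y : R := meval (fun i => y i 0) p.
Definition sphere_integral p : R := sphere_int (peval p).

(** The azimuthal and polar factors of the integral of a monomial; the Jacobian
    accounts for the successor in the exponent of the polar sine. *)
Definition monomial_integral (m : multinom 3) : R :=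
  sincos_int (2 * pi) (m i1) (m i0) * sincos_int pi (m i0 + m i1).+1 (m i2).

Lemma peval_spoint_monomial (m : multinom 3) theta phi :
  peval (mpolyX R m) (spoint theta phi) * sin theta =
  (sin theta ^+ (m i0 + m i1).+1 * cos theta ^+ m i2) *
  (sin phi ^+ m i1 * cos phi ^+ m i0).
Proof.
rewrite /peval mevalX !big_ord_recl big_ord0 !mxE /= !exprMn exprS exprD.
ring.
Qed.

Lemma sphere_integral_wE k p : (msize p <= k)%N ->
  sphere_integral p =
  \sum_(m : bmultinom 3 k) mcoeff m p * monomial_integral m.
Proof.
move=> pk.
pose S (m : bmultinom 3 k) (theta : R) :=
  sin theta ^+ (m i0 + m i1).+1 * cos theta ^+ m i2.
pose A (m : bmultinom 3 k) (phi : R) := sin phi ^+ m i1 * cos phi ^+ m i0.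
have cA m : continuous (A m) by exact: continuous_sincos.
have iA m : mu.-integrable `[0, 2 * pi[ (EFin \o A m).
  exact: (continuous_integrable 0 (2 * pi) true true (cA m)).
have JE m : \int[mu]_(phi in `[0, 2 * pi[) A m phi =
            sincos_int (2 * pi) (m i1) (m i0).
  by rewrite Rintegral_itv_bndo_bndc.
rewrite /sphere_integral /sphere_int.
transitivity (\int[mu]_(theta in `[0, pi])
   \sum_(m : bmultinom 3 k) (mcoeff m p * sincos_int (2 * pi) (m i1) (m i0)) * S m theta).
  apply: eq_Rintegral => theta _.
  transitivity (\int[mu]_(phi in `[0, 2 * pi[)
     \sum_(m : bmultinom 3 k) (mcoeff m p * S m theta) * A m phi).
    apply: eq_Rintegral => phi _.
    rewrite {1}(mpolywE pk) /peval raddf_sum mulr_suml.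
    apply: eq_bigr => m _.
    transitivity (mcoeff m p *
        (peval (mpolyX R m) (spoint theta phi) * sin theta)).
      by rewrite mulrA /= mevalZ.
    rewrite peval_spoint_monomial; exact: mulrA.
  rewrite (Rintegral_lincomb _ (measurable_itv _) iA).
  by apply: eq_bigr => m _; rewrite JE mulrAC.
rewrite (Rintegral_lincomb _ (measurable_itv _)
  (fun m : bmultinom 3 k => integrable_sincos pi (m i0 + m i1).+1 (m i2))).
by apply: eq_bigr => m _; rewrite mulrA.
Qed.

Lemma sphere_integralD p q :
  sphere_integral (p + q) = sphere_integral p + sphere_integral q.
Proof.
pose k := maxn (msize p) (msize q).
rewrite (@sphere_integral_wE k) ?msizeD_le //.
rewrite (@sphere_integral_wE k) ?leq_maxl // (@sphere_integral_wE k) ?leq_maxr //.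
by rewrite -big_split; apply: eq_bigr => m _; rewrite mcoeffD mulrDl.
Qed.

Lemma sphere_integralCM c p :
  sphere_integral (C c * p) = c * sphere_integral p.
Proof.
rewrite mul_mpolyC (@sphere_integral_wE (msize p)) ?msizeZ_le //.
rewrite (@sphere_integral_wE (msize p)) // mulr_sumr.
by apply: eq_bigr => m _; rewrite mcoeffZ mulrA.
Qed.

Lemma sphere_integral0 : sphere_integral 0 = 0.
Proof. by rewrite -(mul0r 0) -[X in X * _]mpolyC0 sphere_integralCM mul0r. Qed.

Lemma sphere_integral_nat n p :
  sphere_integral (n%:R * p) = n%:R * sphere_integral p.
Proof. by rewrite -[X in X * p](rmorph_nat C) sphere_integralCM. Qed.

Lemma sphere_integral_sum (I : finType) (F : I -> poly3) :
  sphere_integral (\sum_i F i) = \sum_i sphere_integral (F i).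
Proof. exact: (big_morph _ sphere_integralD sphere_integral0). Qed.

Lemma sphere_integral_monomial m :
  sphere_integral (mpolyX R m) = monomial_integral m.
Proof.
rewrite (@sphere_integral_wE (mdeg m).+1) ?msizeX //.
rewrite (bigD1 (BMultinom (ltnSn (mdeg m)))) //= mcoeffX eqxx mul1r.
rewrite big1 ?addr0 // => m' m'm; rewrite mcoeffX (_ : m == m' = false) ?mul0r //.
by apply/negbTE/eqP => e; case/eqP: m'm; apply: val_inj; exact: esym.
Qed.

Lemma sphere_dot y : sphere y -> dot3 y y = 1.
Proof.
rewrite /sphere /= => h; have : Num.sqrt (dot3 y y) ^+ 2 = 1 by rewrite h expr1n.
rewrite sqr_sqrtr // /dot3 sumr_ge0 // => i _; exact: sqr_ge0.
Qed.

Lemma spoint_sphere theta phi : sphere (spoint theta phi : 'cV[R]_3).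
Proof.
rewrite /sphere /= /dot3 !big_ord_recl big_ord0 !mxE /=.
rewrite (_ : _ + _ = 1) ?sqrtr1 //.
have h1 := cos2Dsin2 theta; have h2 := cos2Dsin2 phi.
rewrite -[RHS]h1 -[X in _ = _ + X]mulr1 -h2; ring.
Qed.

Lemma peval_sq_norm y : peval sq_norm y = dot3 y y.
Proof.
rewrite /peval /sq_norm raddf_sum; apply: eq_bigr => i _.
by rewrite /= mevalM !mevalXU.
Qed.

Lemma eq_sphere_int (f g : 'cV[R]_3 -> R) :
  (forall y, sphere y -> f y = g y) -> sphere_int f = sphere_int g.
Proof.
move=> fg; apply: eq_Rintegral => theta _; apply: eq_Rintegral => phi _.
by rewrite fg //; exact: spoint_sphere.
Qed.

Lemma sphere_integral_restrict p : sphere_int (peval p) = sphere_integral p.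
Proof. by []. Qed.

Lemma sphere_integral_sq_normM p :
  sphere_integral (sq_norm * p) = sphere_integral p.
Proof.
apply: eq_sphere_int => y sy.
by rewrite /peval mevalM -!/(peval _ y) peval_sq_norm sphere_dot // mul1r.
Qed.

Lemma sphere_integral_sqr_ge0 p : 0 <= sphere_integral (p * p).
Proof.
apply: Rintegral_ge0 => theta th; apply: Rintegral_ge0 => phi _.
rewrite /peval mevalM -expr2 mulr_ge0 ?sqr_ge0 //.
by apply: sin_ge0_pi; move: th; rewrite /= in_itv.
Qed.

Lemma sphere_integral1 : sphere_integral 1 = 4 * pi.
Proof.
have p0 : 0 < pi :> R := pi_gt0 R.
rewrite -mpolyX0 sphere_integral_monomial /monomial_integral !mnm0E.
have -> : sincos_int (2 * pi) 0 0 = 2 * pi :> R.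
  rewrite /sincos_int; under eq_Rintegral do rewrite !expr0 mulr1.
  rewrite Rintegral_cst; last exact: measurable_itv.
  by rewrite /= lebesgue_measure_itv /= lte_fin mulr_gt0 //= subr0 mul1r.
rewrite addn0; have -> : sincos_int pi 1 0 = 2 :> R.
  have cg : continuous (fun x : R => sin x ^+ 1 * cos x ^+ 0).
    exact: continuous_sincos.
  rewrite /sincos_int (Rintegral_FTC p0 cg (F := fun x : R => - cos x)
    (fun x : R => is_derive_eq (is_deriveN (is_derive_cos x)) _)).
    by rewrite cospi cos0; ring.
  by move=> x0; rewrite opprK expr1 expr0 mulr1.
ring.
Qed.

Let natSn_neq0 n : n.+1%:R != 0 :> R.
Proof. by rewrite pnatr_eq0. Qed.

(** Combines the recursions of the azimuthal factor u and of the polar factor v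
    into one for their product: the integer that multiplies the new azimuthal
    value is the one that the polar recursion produces, so it cancels. *)
Let product_recursion k k' l l' n (u u' v v' : R) :
    k%:R * u' = n%:R * u -> l%:R * v' = k'%:R * v ->
  k = k' -> l = l' -> k%:R * (l'%:R * (u' * v')) = k%:R * (n%:R * (u * v)).
Proof.
move=> h1 h2 kk ll; move: h2; rewrite -kk -ll => h2.
rewrite [LHS](_ : _ = (k%:R * u') * (l%:R * v')); last ring.
by rewrite h1 h2; ring.
Qed.

(** The moments of the surface measure obey the recursion that the divergence
    theorem predicts, in each of the three coordinates. *)
Lemma monomial_integralXU (i : 'I_3) (m : multinom 3) :
  (mdeg m + 2)%:R * monomial_integral (mnm_add (mnm1 i) m) =
  (m i)%:R * monomial_integral (mnm_sub m (mnm1 i)).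
Proof.
have p0 : 0 < pi :> R := pi_gt0 R.
have p20 : 0 < 2 * pi :> R by rewrite mulr_gt0.
have s2 : sin (2 * pi) = 0 :> R by rewrite mulr_natl sin2pi.
have c2 : cos (2 * pi) = 1 :> R by rewrite mulr_natl cos2pi.
have sp := sinpi R.
rewrite /monomial_integral mdegE !big_ord_recl big_ord0 !mnmDE !mnmBE !mnm1E.
set a := m i0; set b := m i1; set c := m i2.
have [->|[->|->]] : i = i0 \/ i = i1 \/ i = i2.
  by case: i => [[|[|[|//]]] hi]; [left | right; left | right; right]; exact: val_inj.
- rewrite -/a /= !add0n !subn0 add1n.
  case: (posnP a) => [->|].
    by rewrite mul0r sincos_int_cos1 // mul0r mulr0.
  case: a => // a _; rewrite subSS subn0 addSn.
  apply: (mulfI (natSn_neq0 (b + a).+1)).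
  have h1 := sincos_intSS_cos p20 s2 b a; rewrite addn2 in h1.
  have h2 := sincos_intSS_sin p0 sp (a + b).+1 c.
  apply: (product_recursion h1 h2); lia.
- rewrite -/b /= !add0n !subn0 add1n.
  case: (posnP b) => [->|].
    by rewrite mul0r sincos_int_sin1 // mul0r mulr0.
  case: b => // b _; rewrite subSS subn0 [(a + b.+2)%N]addnS [(a + b.+1)%N]addnS.
  apply: (mulfI (natSn_neq0 (b + a).+1)).
  have h1 := sincos_intSS_sin p20 s2 b a; rewrite addn2 in h1.
  have h2 := sincos_intSS_sin p0 sp (a + b).+1 c.
  apply: (product_recursion h1 h2); lia.
- rewrite -/c /= !add0n !subn0 add1n.
  case: (posnP c) => [->|].
    by rewrite mul0r sincos_int_cos1 // mulr0 mulr0.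
  case: c => // c _; rewrite subSS subn0.
  have h := sincos_intSS_cos p0 sp (a + b).+1 c.
  rewrite mulrCA (_ : (_ + _)%N = ((a + b).+1 + c + 2)%N); last lia.
  by rewrite h mulrCA.
Qed.

End SphereIntegral.

(* Unification must compare the integrands, not unfold the iterated integral. *)
Global Opaque sphere_integral.

(** * Zonal harmonics and their reproducing property *)

Section Zonal.
Context {R : realType}.
Local Notation poly3 := (mpoly 3 R).
Local Notation "''Y_' i" := (mpolyX R (mnm1 i))
  (at level 8, i at level 2, format "''Y_' i").
Local Notation C := (@mpolyC 3 R).
Local Notation I := (@sphere_integral R).
Implicit Types (p q : poly3) (x y : 'cV[R]_3).

Lemma euler_monomial (m : multinom 3) :
  euler (mpolyX R m) = (mdeg m)%:R * mpolyX R m.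
Proof.
rewrite /euler mdegE natr_sum mulr_suml; apply: eq_bigr => i _.
rewrite mderivX -mul_mpolyC mulrCA -mpolyXD rmorph_nat.
case: (posnP (m i)) => [->|mi]; first by rewrite !mul0r.
congr (_ * mpolyX R _); apply/mnmP => j; rewrite mnmDE mnmBE mnm1E.
by case: eqP mi => [<-|_ _]; [lia | rewrite subn0].
Qed.

Lemma mcoeff_euler p m : mcoeff m (euler p) = (mdeg m)%:R * mcoeff m p.
Proof.
elim/mpolyind: p => [|c m' p _ _ IH].
  by rewrite /euler big1 ?mcoeff0 ?mulr0 // => i _; rewrite mderiv0 mulr0.
rewrite -mul_mpolyC eulerD eulerCM euler_monomial !mcoeffD IH mulrDr.
congr (_ + _); rewrite -(rmorph_nat C) mulrCA !mul_mpolyC !mcoeffZ mcoeffX.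
by case: eqP => [->|_]; rewrite ?mulr1 ?mulr0 // mulrC.
Qed.

Lemma dhomog_homogeneous l p : p \is ishomog1 l mdeg -> homogeneous l p.
Proof.
move=> hp; apply/mpolyP => m; rewrite mcoeff_euler -(rmorph_nat C) mul_mpolyC.
rewrite mcoeffZ; have [->//|ml] := eqVneq (mdeg m) l.
by rewrite (dhomog_nemf_coeff hp ml) !mulr0.
Qed.

Lemma homogeneous0_const p : homogeneous 0 p -> p = C (mcoeff mnm0 p).
Proof.
move=> hp; apply/mpolyP => m; rewrite mcoeffC.
have [->|m0] := eqVneq m mnm0; first by rewrite mulr1.
rewrite mulr0; have := mcoeff_euler p m.
rewrite hp mul0r mcoeff0 => /esym /eqP; rewrite mulf_eq0 pnatr_eq0 mdeg_eq0.
by rewrite (negbTE m0) => /eqP.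
Qed.

(** The divergence theorem on the unit ball for the field p e_i.  When p is
    homogeneous of degree d, the left-hand integrand is (d + 2) 'Y_i p, and
    1 / (d + 2) is the radial integral of the derivative of p.  The Euler operator
    makes the identity linear in p, so that it only concerns monomials. *)
Lemma sphere_integral_divergence i p :
  I ('Y_i * (euler p + 2 * p)) = I (mderiv i p).
Proof.
elim/mpolyind: p => [|c m p _ _ IH].
  by rewrite /euler big1 ?mulr0 ?addr0 ?mulr0 ?mderiv0 // => j _; rewrite mderiv0 mulr0.
have key : I ('Y_i * (euler (mpolyX R m) + 2 * mpolyX R m)) =
           I (mderiv i (mpolyX R m)).
  rewrite euler_monomial -mulrDl -natrD mulrCA -mpolyXD sphere_integral_nat.
  rewrite mderivX -mul_mpolyC sphere_integralCM !sphere_integral_monomial.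
  exact: monomial_integralXU.
rewrite -mul_mpolyC eulerD eulerCM mderivD mderivCM.
rewrite (_ : _ * _ = C c * ('Y_i * (euler (mpolyX R m) + 2 * mpolyX R m)) +
   'Y_i * (euler p + 2 * p)); last by ring.
by rewrite !sphere_integralD IH !sphere_integralCM key.
Qed.

(** Multiplying out a p as the Euler operator turns each coordinate factor into
    a derivative under the integral; the Laplacian of p drops out. *)
Lemma sphere_integral_grad a b p q : harmonic a p -> homogeneous b q ->
  a%:R * (a + b).+1%:R * I (p * q) = I (grad_dot p q).
Proof.
move=> [hp lp] hq.
have e i : euler (mderiv i p * q) + 2 * (mderiv i p * q) =
           (a + b).+1%:R * (mderiv i p * q).
  have := mderiv_euler i p; rewrite hp -(rmorph_nat C) mderivCM rmorph_nat => h.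
  have {}h : euler (mderiv i p) = a%:R * mderiv i p - mderiv i p.
    by rewrite h addrK.
  by rewrite eulerM h hq -[(a + b).+1%:R]natr1 natrD; ring.
have -> : grad_dot p q = \sum_(i < 3) mderiv i (mderiv i p * q).
  under [RHS]eq_bigr do rewrite mderivM.
  by rewrite big_split /= -mulr_suml -/(laplacian p) lp mul0r add0r.
rewrite sphere_integral_sum.
under eq_bigr do rewrite -sphere_integral_divergence e mulrCA sphere_integral_nat.
rewrite -mulr_sumr -sphere_integral_sum.
have -> : \sum_(i < 3) 'Y_i * (mderiv i p * q) = a%:R * (p * q).
  by rewrite mulrA -hp /euler mulr_suml; apply: eq_bigr => i _; rewrite mulrA.
by rewrite sphere_integral_nat; ring.
Qed.

(** The gradient form of the integral is symmetric in its two arguments, whereas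
    its factor is the degree of the first one. *)
Lemma harmonic_orthogonal a b p q :
  harmonic a p -> harmonic b q -> a != b -> I (p * q) = 0.
Proof.
move=> hp hq ab.
have h1 := sphere_integral_grad hp hq.1.
have h2 := sphere_integral_grad hq hp.1.
have : (a%:R - b%:R) * (a + b).+1%:R * I (p * q) = 0.
  by rewrite !mulrBl h1 [(a + b)%N]addnC [p * q]mulrC h2 grad_dotC subrr.
move/eqP; rewrite !mulf_eq0 subr_eq0 eqr_nat (negbTE ab) pnatr_eq0 /=.
by move/eqP.
Qed.

Lemma pevalM p q y : peval (p * q) y = peval p y * peval q y.
Proof. exact: mevalM. Qed.

Lemma pevalD p q y : peval (p + q) y = peval p y + peval q y.
Proof. exact: mevalD. Qed.

Lemma pevalB p q y : peval (p - q) y = peval p y - peval q y.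
Proof. exact: mevalB. Qed.

Lemma pevalC c y : peval (C c) y = c.
Proof. exact: mevalC. Qed.

Lemma peval_nat n y : peval n%:R y = n%:R.
Proof. by rewrite -(rmorph_nat C) pevalC. Qed.

Lemma peval_sum (F : 'I_3 -> poly3) y :
  peval (\sum_i F i) y = \sum_i peval (F i) y.
Proof. exact: (raddf_sum (meval (fun i => y i 0))). Qed.

Lemma peval_linear_form x y : peval (linear_form x) y = dot3 x y.
Proof.
by rewrite peval_sum; apply: eq_bigr => i _; rewrite pevalM pevalC /peval mevalXU.
Qed.

Lemma peval_dir_deriv_self x p : peval (dir_deriv x p) x = peval (euler p) x.
Proof.
rewrite !peval_sum; apply: eq_bigr => i _.
by rewrite !pevalM pevalC /peval mevalXU.
Qed.

(** Two consecutive solid zonal harmonics (Z_(l-1), Z_l) with pole x: the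
    recursion is Bonnet's for Legendre polynomials, made homogeneous, with 0
    as Z_(-1). *)
Fixpoint zonal_pair x l : poly3 * poly3 :=
  if l is k.+1 then
    let: (u, v) := zonal_pair x k in
    (v, C (k.+1%:R^-1) *
        ((2 * k%:R + 1) * (linear_form x * v) - k%:R * (sq_norm * u)))
  else (0, 1).

Definition zonal x l := (zonal_pair x l).2.

Lemma zonalS x l : zonal x l.+1 = C (l.+1%:R^-1) *
  ((2 * l%:R + 1) * (linear_form x * zonal x l) -
   l%:R * (sq_norm * zonal x l.-1)).
Proof.
rewrite /zonal; case: l => [|l] /=; first by rewrite !mul0r.
by case: (zonal_pair x l).
Qed.

Lemma zonal0 x : zonal x 0 = 1. Proof. by []. Qed.

Lemma zonal1 x : zonal x 1 = linear_form x.
Proof. by rewrite zonalS zonal0 invr1 mpolyC1; ring. Qed.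

Let CinvK n p : C (n.+1%:R^-1) * (n.+1%:R * p) = p.
Proof.
by rewrite mulrA -(rmorph_nat C) -mpolyCM mulVf ?mpolyC1 ?mul1r ?pnatr_eq0.
Qed.

Let nat_homogeneous n k p : homogeneous k p -> homogeneous k (n%:R * p).
Proof. by move=> hp; rewrite -(rmorph_nat C); exact: homogeneousCM. Qed.

Let laplacian_natM n p : laplacian (n%:R * p) = n%:R * laplacian p.
Proof. by rewrite -(rmorph_nat C) laplacianCM. Qed.

Let dir_deriv_natM x n p : dir_deriv x (n%:R * p) = n%:R * dir_deriv x p.
Proof. by rewrite -(rmorph_nat C) dir_derivCM. Qed.

Let opp_natM n p : - (n%:R * p) = C (-1) * (n%:R * p).
Proof. by rewrite mpolyCN mpolyC1 mulN1r. Qed.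

(** The two claims need each other: the derivative along the pole lowers the
    degree, and this is what cancels the Laplacians of the two terms of the
    recursion. *)
Lemma zonal_harmonic_dir_deriv x l : dot3 x x = 1 ->
  harmonic l (zonal x l) /\ dir_deriv x (zonal x l) = l%:R * zonal x l.-1.
Proof.
move=> x1.
suff: (harmonic l (zonal x l) /\ dir_deriv x (zonal x l) = l%:R * zonal x l.-1)
   /\ (harmonic l.+1 (zonal x l.+1) /\
       dir_deriv x (zonal x l.+1) = l.+1%:R * zonal x l).
  by case.
elim: l => [|l [[hZ dZ] [hZ1 dZ1]]].
  rewrite zonal0 zonal1; split; split.
  - split; first by rewrite /homogeneous -mpolyC1 /euler big1 ?mul0r // => i _;
      rewrite mderivC mulr0.
    by rewrite /laplacian big1 // => i _; rewrite -mpolyC1 mderivC mderiv0.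
  - by rewrite mul0r /dir_deriv big1 // => i _; rewrite -mpolyC1 mderivC mulr0.
  - by split; [exact: homogeneous_linear_form | exact: laplacian_linear_form].
  - by rewrite dir_deriv_linear_form x1 mpolyC1 mulr1.
split=> //; rewrite zonalS /=.
have odd_nat : 2 * l.+1%:R + 1 = (2 * l.+1).+1%:R :> poly3.
  by rewrite -[RHS]natr1 natrM.
rewrite odd_nat opp_natM; split; first split.
- apply: homogeneousCM; apply: homogeneousD.
    apply: nat_homogeneous.
    exact: (homogeneousM (homogeneous_linear_form x) hZ1.1).
  apply/homogeneousCM/nat_homogeneous.
  exact: (homogeneousM homogeneous_sq_norm hZ.1).
- rewrite laplacianCM laplacianD laplacianCM !laplacian_natM.
  rewrite (laplacian_linear_formM x hZ1) (laplacian_sq_normM hZ) dZ1.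
  rewrite mpolyCN mpolyC1 -odd_nat -[l.+1%:R]natr1; ring.
- rewrite -[RHS](CinvK l.+1) dir_derivCM; congr (_ * _).
  rewrite dir_derivD dir_derivCM !dir_deriv_natM !dir_derivM.
  rewrite dir_deriv_linear_form x1 dir_deriv_sq_norm dZ1 dZ mpolyC1.
  have zS := zonalS x l.
  have {zS}: l.+1%:R * zonal x l.+1 =
      (2 * l%:R + 1) * (linear_form x * zonal x l) -
       l%:R * (sq_norm * zonal x l.-1).
    by rewrite zS mulrCA CinvK.
  move=> zS.
  transitivity ((2 * l.+1).+1%:R * zonal x l.+1 + l.+1%:R *
    ((2 * l%:R + 1) * (linear_form x * zonal x l) -
       l%:R * (sq_norm * zonal x l.-1))).
    by rewrite mpolyCN mpolyC1 -odd_nat -[l.+1%:R]natr1; ring.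
  by rewrite -zS -odd_nat -[l.+2%:R]natr1 -[l.+1%:R]natr1; ring.
Qed.

Lemma zonal_harmonic x l : dot3 x x = 1 -> harmonic l (zonal x l).
Proof. by move=> x1; case: (zonal_harmonic_dir_deriv l x1). Qed.

(** The recursion moves a linear form from the zonal harmonic onto q.  The
    decomposition of the product leaves, up to terms of other degrees, the
    derivative of q along the pole, and by Euler's identity that derivative still
    evaluates q at the pole. *)
Lemma zonal_reproducing x l q : dot3 x x = 1 -> harmonic l q ->
  I (zonal x l * q) = 4 * pi / (2 * l%:R + 1) * peval q x.
Proof.
move=> x1; elim: l q => [|l IH] q hq.
  rewrite zonal0 mulr0 add0r divr1 (homogeneous0_const hq.1).
  by rewrite [1 * _]mulrC sphere_integralCM sphere_integral1 pevalC mulrC.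
have odd_nz n : 2 * n%:R + 1 != 0 :> R by rewrite -natrM natr1 pnatr_eq0.
set h := linear_form x * q + C (- (2 * l.+1%:R + 1)^-1) * (sq_norm * dir_deriv x q).
have hh : harmonic l.+2 h by exact: linear_form_decomp.
have split_q : linear_form x * q =
    h + C ((2 * l.+1%:R + 1)^-1) * (sq_norm * dir_deriv x q).
  by rewrite /h rmorphN; ring.
(* Only the lower of the two degrees in the decomposition meets zonal x l. *)
have I1 : I (linear_form x * zonal x l * q) =
    (2 * l.+1%:R + 1)^-1 * (4 * pi / (2 * l%:R + 1) * (l.+1%:R * peval q x)).
  rewrite mulrAC mulrC split_q mulrDr sphere_integralD.
  rewrite (harmonic_orthogonal (zonal_harmonic l x1) hh) ?add0r; last first.
    by rewrite -addn2 -[X in X != _]addn0 eqn_add2l.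
  rewrite mulrCA sphere_integralCM mulrCA sphere_integral_sq_normM.
  rewrite (IH _ (harmonic_dir_deriv x hq)) peval_dir_deriv_self hq.1.
  by rewrite pevalM peval_nat.
have I2 : l%:R * I (zonal x l.-1 * q) = 0.
  rewrite (harmonic_orthogonal (zonal_harmonic l.-1 x1) hq) ?mulr0 //.
  by apply/eqP; lia.
rewrite zonalS -mulrA sphere_integralCM mulrBl.
have odd_nat : 2 * l%:R + 1 = (2 * l).+1%:R :> poly3.
  by rewrite -[RHS]natr1 natrM.
rewrite odd_nat -!mulrA opp_natM.
rewrite sphere_integralD sphere_integralCM !sphere_integral_nat.
rewrite sphere_integral_sq_normM I2 mulr0 addr0 [linear_form x * _]mulrA I1.
have l_nz : 1 + l%:R != 0 :> R by rewrite nat1r pnatr_eq0.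
have odd_nz1 : 2 * (1 + l%:R) + 1 != 0 :> R by rewrite nat1r; exact: odd_nz.
rewrite -[(2 * l).+1%:R]natr1 natrM; field.
by apply/and3P; split; [exact: odd_nz1 | exact: odd_nz | exact: l_nz].
Qed.

Lemma peval_zonalS x l y : sphere y ->
  l.+1%:R * peval (zonal x l.+1) y =
  (2 * l%:R + 1) * dot3 x y * peval (zonal x l) y - l%:R * peval (zonal x l.-1) y.
Proof.
move=> sy; rewrite zonalS pevalM pevalC mulrA divff ?pnatr_eq0 // mul1r.
rewrite pevalB !pevalM pevalD pevalM !peval_nat peval_linear_form.
by rewrite peval_sq_norm (sphere_dot sy) -(mpolyC1 3 R) pevalC; ring.
Qed.

Lemma peval_zonal_pole x l : sphere x -> peval (zonal x l) x = 1.
Proof.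
move=> sx.
suff: peval (zonal x l) x = 1 /\ peval (zonal x l.+1) x = 1 by case.
elim: l => [|l [h0 h1]].
  by rewrite zonal0 zonal1 -(mpolyC1 3 R) pevalC peval_linear_form sphere_dot.
split=> //; have nz : l.+2%:R != 0 :> R by rewrite pnatr_eq0.
apply: (mulfI nz); rewrite peval_zonalS // h0 h1 (sphere_dot sx).
by rewrite -[l.+2%:R]natr1 -[l.+1%:R]natr1; ring.
Qed.

Lemma sphere_integral_zonal_diff x y l : sphere x -> sphere y ->
  I ((zonal x l - zonal y l) * (zonal x l - zonal y l)) =
  4 * pi / (2 * l%:R + 1) * (2 * (1 - peval (zonal x l) y)).
Proof.
move=> sx sy.
have hx := zonal_harmonic l (sphere_dot sx).
have hy := zonal_harmonic l (sphere_dot sy).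
have xx := zonal_reproducing (sphere_dot sx) hx.
have xy := zonal_reproducing (sphere_dot sx) hy.
have yx := zonal_reproducing (sphere_dot sy) hx.
have yy := zonal_reproducing (sphere_dot sy) hy.
move: xx xy yx yy; rewrite !peval_zonal_pole // [zonal y l * zonal x l]mulrC.
set K := 4 * pi / (2 * l%:R + 1); set P := peval _ y => xx xy yx yy.
rewrite (_ : _ * _ = zonal x l * zonal x l + C (-2) * (zonal x l * zonal y l)
                     + zonal y l * zonal y l); last first.
  by rewrite rmorphN rmorph_nat; ring.
rewrite !sphere_integralD sphere_integralCM xx yx yy; ring.
Qed.

Lemma peval_zonal_le1 x y l : sphere x -> sphere y -> peval (zonal x l) y <= 1.
Proof.
move=> sx sy; have := sphere_integral_sqr_ge0 (zonal x l - zonal y l).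
rewrite sphere_integral_zonal_diff // pmulr_rge0; last first.
  by rewrite divr_gt0 ?mulr_gt0 ?pi_gt0 // -natrM natr1 ltr0n.
by rewrite pmulr_rge0 // subr_ge0.
Qed.

(** Consecutive differences of Legendre values satisfy a first-order recursion
    whose source term is at most (2l + 1)(1 - c), because Legendre polynomials
    are at most 1 on [-1, 1]; summing twice gives the bound, which is the one
    coming from the slope of the Legendre polynomial at 1. *)
Lemma peval_zonal_ge x y l : sphere x -> sphere y ->
  1 - peval (zonal x l) y <= l%:R * l.+1%:R / 2 * (1 - dot3 x y).
Proof.
move=> sx sy; pose P k := peval (zonal x k) y.
have c1 : 0 <= 1 - dot3 x y.
  by rewrite subr_ge0 -peval_linear_form -zonal1 peval_zonal_le1.
have step k : k.+1%:R * (P k - P k.+1) <= k.+1%:R ^+ 2 * (1 - dot3 x y).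
  elim: k => [|k IH].
    by rewrite /P zonal0 zonal1 -(mpolyC1 3 R) pevalC peval_linear_form expr1n.
  have rec := peval_zonalS x k.+1 sy; rewrite -/(P _) -/(P _) -/(P _) /= in rec.
  rewrite mulrBr rec -/(P _).
  have : (2 * k.+1%:R + 1) * (1 - dot3 x y) * P k.+1 <=
         (2 * k.+1%:R + 1) * (1 - dot3 x y).
    by rewrite ler_piMr ?peval_zonal_le1 // mulr_ge0 // -natrM natr1 ler0n.
  move: IH; rewrite -[k.+2%:R]natr1.
  set n : R := k.+1%:R; rewrite mulrBr => IH h; lra.
rewrite -/(P l); elim: l => [|l IH].
  by rewrite /P zonal0 -(mpolyC1 3 R) pevalC subrr !mul0r.
have {}step : P l - P l.+1 <= l.+1%:R * (1 - dot3 x y).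
  by rewrite -(@ler_pM2l _ l.+1%:R) ?ltr0n // mulrA -expr2 step.
move: IH step; rewrite -[l.+2%:R]natr1 -[l.+1%:R]natr1; lra.
Qed.

(** The difference q(x) - q(y) is, up to a factor, the inner product of q with
    the difference of the zonal harmonics with poles x and y, whose norm is a
    Legendre value: the bound is the Cauchy-Schwarz inequality. *)
Lemma harmonic_lipschitz_dot x y l q : sphere x -> sphere y ->
  harmonic l q -> I (q * q) = 1 ->
  (peval q x - peval q y) ^+ 2 <=
  (2 * l%:R + 1) / (4 * pi) * (l%:R * l.+1%:R * (1 - dot3 x y)).
Proof.
move=> sx sy hq q1.
set K : R := 4 * pi / (2 * l%:R + 1).
have K0 : 0 < K by rewrite divr_gt0 ?mulr_gt0 ?pi_gt0 // -natrM natr1 ltr0n.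
set z := zonal x l - zonal y l.
have Izq : I (z * q) = K * (peval q x - peval q y).
  rewrite (_ : z * q = zonal x l * q + C (-1) * (zonal y l * q)); last first.
    by rewrite /z mpolyCN mpolyC1; ring.
  rewrite sphere_integralD sphere_integralCM.
  rewrite (zonal_reproducing (sphere_dot sx) hq).
  by rewrite (zonal_reproducing (sphere_dot sy) hq) -/K; ring.
have Izz : I (z * z) = K * (2 * (1 - peval (zonal x l) y)).
  exact: sphere_integral_zonal_diff.
set B := I (z * q).
(* As q has norm 1, the square of B q - z has integral I (z * z) - B ^ 2. *)
have : 0 <= I ((C B * q - z) * (C B * q - z)) by exact: sphere_integral_sqr_ge0.
rewrite (_ : _ * _ = C (B ^+ 2) * (q * q) + C (- 2 * B) * (z * q) + z * z); last first.
  by rewrite !rmorphM rmorphN rmorph_nat /=; ring.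
rewrite !sphere_integralD !sphere_integralCM q1 -/B Izz.
rewrite (_ : _ + _ = K * (2 * (1 - peval (zonal x l) y)) - B ^+ 2); last ring.
rewrite subr_ge0 /B Izq exprMn expr2 -mulrA ler_pM2l // => h.
have h2 := peval_zonal_ge l sx sy.
rewrite (_ : (2 * l%:R + 1) / (4 * pi) = K^-1); last by rewrite invf_div.
rewrite -(ler_pM2l K0) [leRHS]mulrA divff ?mul1r ?gt_eqF //.
move: h h2; clear; move: (peval (zonal x l) y) (dot3 x y) => P c.
move: (K * _) (l%:R * l.+1%:R) => d m h h2; lra.
Qed.

End Zonal.

(** * Geodesic distance on the sphere *)

Section SphericalDistance.
Context {R : realType}.
Implicit Types x y : 'cV[R]_3.

Lemma sphere_dot_bound x y : sphere x -> sphere y -> -1 <= dot3 x y <= 1.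
Proof.
move=> /sphere_dot sx /sphere_dot sy.
have hB : 0 <= \sum_(i < 3) (x i 0 - y i 0) ^+ 2.
  by apply: sumr_ge0 => i _; exact: sqr_ge0.
have hD : 0 <= \sum_(i < 3) (x i 0 + y i 0) ^+ 2.
  by apply: sumr_ge0 => i _; exact: sqr_ge0.
move: sx sy hB hD; rewrite /dot3 !big_ord_recl !big_ord0.
move: (x _ _) (x _ _) (x _ _) (y _ _) (y _ _) (y _ _) => x1 x2 x3 y1 y2 y3.
move=> sx sy hB hD; apply/andP; split; nra.
Qed.

Lemma cos_ge_quadratic (d : R) : 0 <= d -> 1 - cos d <= d ^+ 2 / 2.
Proof.
move=> d0; set u := d / 2; have du : d = u *+ 2 by rewrite /u mulr2n; lra.
have u0 : 0 <= u by rewrite /u divr_ge0.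
have [c _ hc] : exists2 c, c \in `[0, u] & sin u - sin 0 = cos c * (u - 0).
  apply: MVT_segment => //.
  exact/continuous_subspaceT/continuous_sin.
move: hc; rewrite sin0 !subr0 => su.
rewrite du cos_mulr2n; have hs := cos2Dsin2 u.
have hc : cos c ^+ 2 <= 1 by have := cos2Dsin2 c; have := sqr_ge0 (sin c); lra.
have : sin u ^+ 2 <= u ^+ 2 by rewrite su exprMn ler_piMl // sqr_ge0.
rewrite (_ : (u *+ 2) ^+ 2 / 2 = 2 * u ^+ 2); last by rewrite -mulr_natl; field.
move: hs; rewrite !mulr2n; lra.
Qed.

Lemma sdist_bounds x y : sphere x -> sphere y -> 0 <= sdist x y <= pi.
Proof.
by move=> sx sy; rewrite acos_ge0 ?acos_lepi // sphere_dot_bound.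
Qed.

Lemma cos_sdist x y : sphere x -> sphere y -> cos (sdist x y) = dot3 x y.
Proof. by move=> sx sy; rewrite acosK // in_itv /= sphere_dot_bound. Qed.

Lemma sdist_le x y (g : R) : sphere x -> sphere y -> 0 <= g <= pi ->
  (sdist x y <= g) = (cos g <= dot3 x y).
Proof.
move=> sx sy hg; rewrite -cos_sdist // leNgt [RHS]leNgt; congr (~~ _).
by rewrite ltr_cos ?in_itv /= ?sdist_bounds.
Qed.

Lemma dot3_chord_le x y : sphere x -> sphere y ->
  1 - dot3 x y <= sdist x y ^+ 2 / 2.
Proof.
move=> sx sy; rewrite -cos_sdist //; apply: cos_ge_quadratic.
by case/andP: (sdist_bounds sx sy).
Qed.

Lemma dot3_spoint (a b c d : R) : dot3 (spoint a b) (spoint c d) =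
  cos a * cos c + sin a * cos (b - d) * sin c.
Proof. rewrite /dot3 !big_ord_recl big_ord0 !mxE /= cosB; ring. Qed.

(** The value at th times sin (b - a) is a combination of the values at a and b
    with coefficients sin (b - th) and sin (th - a), which are nonnegative and, by
    subadditivity of the sine on [0, pi], add up to at least sin (b - a). *)
Lemma sinusoid_ge (A B a b th c : R) : 0 < c -> a <= th <= b -> b - a <= pi ->
  c <= A * cos a + B * sin a -> c <= A * cos b + B * sin b ->
  c <= A * cos th + B * sin th.
Proof.
move=> c0 /andP[ath thb] ba.
set f := fun x : R => A * cos x + B * sin x; rewrite -!/(f _) => ha hb.
have hu : 0 <= sin (th - a) by apply: sin_ge0_pi; lra.
have hv : 0 <= sin (b - th) by apply: sin_ge0_pi; lra.
have interp : f th * sin (b - a) = f a * sin (b - th) + f b * sin (th - a).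
  by rewrite /f !sinB; ring.
have subadd : sin (b - a) <= sin (b - th) + sin (th - a).
  rewrite (_ : b - a = (b - th) + (th - a)); last by ring.
  rewrite sinD; have := cos_le1 (th - a); have := cos_le1 (b - th); nra.
have [eab|nab] := eqVneq a b; first by rewrite (_ : th = a) //; lra.
have ab : a < b by rewrite lt_neqAle nab; lra.
have [epi|npi] := eqVneq (b - a) pi.
  move: hb; rewrite (_ : b = a + pi) ?/f; last by rewrite -epi; ring.
  by rewrite cosDpi sinDpi !mulrN => hb; move: ha; rewrite /f => ha; lra.
have s0 : 0 < sin (b - a) by apply: sin_gt0_pi; rewrite subr_gt0 ab lt_neqAle npi.
rewrite -(ler_pM2r s0) interp; nra.
Qed.

End SphericalDistance.

(** * Rectangles inside their caps *)

Section RectangleInCap.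
Context {R : realType}.
Implicit Type z : srect R.

Lemma rect_radius_bounds z : 0 <= rect_radius z <= pi.
Proof.
have h1 := sdist_bounds (spoint_sphere _ _ : sphere (rect_center z))
  (spoint_sphere _ _ : sphere (vertex1 z)).
have h3 := sdist_bounds (spoint_sphere _ _ : sphere (rect_center z))
  (spoint_sphere _ _ : sphere (vertex3 z)).
rewrite /rect_radius ge_max le_max.
by case/andP: h1 => -> ->; case/andP: h3 => _ ->.
Qed.

(** Along a meridian the cosine of the distance to the centre is a sinusoid in
    the colatitude, and at fixed colatitude it decreases away from the central
    meridian; so the farthest points are the corners.  In wide rectangles around
    the equator they need not be; the bound on the radius excludes these. *)
Lemma rect_set_sub_cap z : rect_radius z < pi / 2 ->
  rect_set z `<=` rect_cap z.
Proof.
move=> r_lt x [theta [phi [hth hph ->]]].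
have sC : sphere (rect_center z) := spoint_sphere _ _.
split; first exact: spoint_sphere.
have rb := rect_radius_bounds z; have p0 := pi_gt0 R.
rewrite sdist_le //; last exact: spoint_sphere.
have c0 : 0 < cos (rect_radius z).
  by apply: cos_gt0_pihalf; case/andP: rb => r0 _; apply/andP; split; lra.
have hv v : sphere v -> sdist (rect_center z) v <= rect_radius z ->
    cos (rect_radius z) <= dot3 (rect_center z) v.
  by move=> sv; rewrite sdist_le.
have h1 := hv _ (spoint_sphere (th_lo z) (ph_lo z)).
have h3 := hv _ (spoint_sphere (th_hi z) (ph_hi z)).
have [m1 m3] : sdist (rect_center z) (spoint (th_lo z) (ph_lo z)) <= rect_radius z /\
    sdist (rect_center z) (spoint (th_hi z) (ph_hi z)) <= rect_radius z.
  by rewrite /rect_radius !le_max !lexx orbT.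
have {h1 h3} [h1 h3] := (h1 m1, h3 m3).
case: (th_bounds z) => tl0 tlh thp; case: (ph_bounds z) => pl0 plh php.
move: h1 h3; rewrite /rect_center !dot3_spoint.
set th0 := (th_lo z + th_hi z) / 2; set D := (ph_hi z - ph_lo z) / 2.
have -> : (ph_lo z + ph_hi z) / 2 - ph_lo z = D by rewrite /D; lra.
have -> : (ph_lo z + ph_hi z) / 2 - ph_hi z = - D by rewrite /D; lra.
rewrite cosN => h1 h3.
have bnd : th_hi z - th_lo z <= pi by lra.
have := sinusoid_ge c0 hth bnd h1 h3; move/le_trans; apply.
rewrite lerD2l ler_wpM2r //; first by apply: sin_ge0_pi; case/andP: hth; lra.
rewrite ler_wpM2l //; first by apply: sin_ge0_pi; rewrite /th0; lra.
set e := _ - phi; rewrite -(cos_norm e).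
have De : `|e| <= D by rewrite ler_norml /e /D; case/andP: hph; lra.
have D0 : 0 <= D by rewrite /D; lra.
have Dpi : D <= pi by rewrite /D; lra.
rewrite leNgt ltr_cos ?in_itv /= -?leNgt ?normr_ge0 ?D0 //.
exact: le_trans De Dpi.
Qed.

End RectangleInCap.

(** * Lipschitz bound for normalised harmonics *)

Section Lipschitz.
Context {R : realType}.

(** Since 1 - cos d <= d ^ 2 / 2, the bound in terms of the scalar product
    becomes a Lipschitz bound for the geodesic distance.  The constant is
    relaxed to (2t + 1) / (4 pi) * (t + 1) ^ 2, uniformly over the degrees l <= t. *)
Lemma harmonic_lipschitz (t l : nat) (f : 'cV[R]_3 -> R) (x y : 'cV[R]_3) :
  (l <= t)%N -> spherical_harmonic l f -> sphere_int (fun z => f z * f z) = 1 ->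
  sphere x -> sphere y ->
  `|f x - f y| <= Num.sqrt ((2 * t%:R + 1) / (4 * pi)) * t.+1%:R * sdist x y.
Proof.
move=> lt [q [hq lq fq]] f1 sx sy.
have harm : harmonic l q by split=> //; exact: dhomog_homogeneous.
have q1 : sphere_integral (q * q) = 1.
  rewrite -f1 -sphere_integral_restrict; apply: eq_sphere_int => z sz.
  by rewrite pevalM !fq.
have p0 := pi_gt0 R; have d0 : 0 <= sdist x y by case/andP: (sdist_bounds sx sy).
have k0 : 0 <= (2 * t%:R + 1) / (4 * pi) :> R.
  by rewrite divr_ge0 ?mulr_ge0 ?(ltW p0) // addr_ge0 // mulr_ge0.
rewrite -(@ler_pXn2r _ 2) ?nnegrE //; last first.
  by rewrite !mulr_ge0 ?sqrtr_ge0.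
rewrite real_normK ?num_real // !exprMn sqr_sqrtr // !fq //.
apply: (le_trans (harmonic_lipschitz_dot sx sy harm q1)).
rewrite -[leRHS]mulrA; apply: ler_pM.
- by rewrite divr_ge0 ?mulr_ge0 ?(ltW p0) // addr_ge0 // mulr_ge0.
- by rewrite !mulr_ge0 // subr_ge0; case/andP: (sphere_dot_bound sx sy).
- rewrite ler_wpM2r ?invr_ge0 ?mulr_ge0 ?(ltW p0) //.
  by rewrite lerD2r ler_wpM2l // ler_nat.
have c := dot3_chord_le sx sy.
have c1 : 1 - dot3 x y <= sdist x y ^+ 2.
  by apply: (le_trans c); rewrite ler_pdivrMr // ler_peMr ?sqr_ge0 // ler1n.
apply: ler_pM => //.
- by rewrite subr_ge0; case/andP: (sphere_dot_bound sx sy).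
- by rewrite expr2; apply: ler_pM; rewrite // ler_nat ?ltnS // ltnW.
Qed.

End Lipschitz.

(** * Spherical polynomials as combinations of harmonics *)

Section PolynomialSpan.
Context {R : realType}.
Variable t : nat.
Local Notation N := (t.+1 ^ 2)%N.
Local Notation i0 := (ord0 : 'I_3).
Local Notation i1 := (lift ord0 ord0 : 'I_3).
Local Notation i2 := (lift ord0 (lift ord0 ord0) : 'I_3).
Implicit Types (f g : 'cV[R]_3 -> R) (x y : 'cV[R]_3).

Definition mono3 a b e y : R := y i0 0 ^+ a * y i1 0 ^+ b * y i2 0 ^+ e.

(** On the sphere the third coordinate is only needed to the power 0 or 1, which
    leaves l + 1 and l monomials of degree l: as many as there are harmonics of
    that degree, and numbered in the same way. *)
Definition reduced_mono (j : nat) y : R :=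
  let l := Nat.sqrt j in let k := (j - l ^ 2)%N in
  if (k <= l)%N then mono3 k (l - k) 0 y
  else mono3 (k - l.+1) (2 * l - k) 1 y.

Definition in_reduced_span f := exists c : 'cV[R]_N,
  forall y, sphere y -> f y = \sum_(j < N) reduced_mono j y * c j 0.

Lemma in_reduced_spanD f g : in_reduced_span f -> in_reduced_span g ->
  in_reduced_span (fun y => f y + g y).
Proof.
move=> [c hc] [d hd]; exists (c + d) => y sy.
by rewrite hc // hd // -big_split; apply: eq_bigr => j _; rewrite mxE mulrDr.
Qed.

Lemma in_reduced_spanZ a f : in_reduced_span f ->
  in_reduced_span (fun y => a * f y).
Proof.
move=> [c hc]; exists (a *: c) => y sy.
by rewrite hc // mulr_sumr; apply: eq_bigr => j _; rewrite mxE mulrCA.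
Qed.

Lemma eq_in_reduced_span f g : (forall y, sphere y -> f y = g y) ->
  in_reduced_span f -> in_reduced_span g.
Proof. by move=> fg [c hc]; exists c => y sy; rewrite -fg // hc. Qed.

Lemma in_reduced_span_sum (I : finType) (F : I -> 'cV[R]_3 -> R) :
  (forall i, in_reduced_span (F i)) -> in_reduced_span (fun y => \sum_i F i y).
Proof.
move=> hF; elim: (index_enum I) => [|i r IH].
  exists 0 => y _; rewrite big_nil big1 // => j _; by rewrite mxE mulr0.
apply: eq_in_reduced_span (in_reduced_spanD (hF i) IH) => y _.
by rewrite big_cons.
Qed.

Lemma reduced_monoE l k y : (k <= 2 * l)%N -> reduced_mono (l ^ 2 + k) y =
  if (k <= l)%N then mono3 k (l - k) 0 y
  else mono3 (k - l.+1) (2 * l - k) 1 y.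
Proof.
move=> kl; rewrite /reduced_mono.
have -> : Nat.sqrt (l ^ 2 + k) = l.
  by apply: PeanoNat.Nat.sqrt_unique; rewrite -mulnn; lia.
by rewrite addKn.
Qed.

Lemma reduced_mono_in_span l k : (l <= t)%N -> (k <= 2 * l)%N ->
  in_reduced_span (reduced_mono (l ^ 2 + k)).
Proof.
move=> lt kl; have jN : (l ^ 2 + k < N)%N.
  rewrite -!mulnn; have : (l * l <= t * t)%N by exact: leq_mul.
  by lia.
exists (\col_i (i == Ordinal jN)%:R) => y _.
rewrite (bigD1 (Ordinal jN)) //= mxE eqxx mulr1 big1 ?addr0 // => i ij.
by rewrite mxE (negbTE ij) mulr0.
Qed.

Lemma mono3_in_span a b e : (a + b + e <= t)%N -> in_reduced_span (mono3 a b e).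
Proof.
have [n] := ubnP e; elim: n a b e => // n IH a b [|[|e]] /ltnSE en deg.
- apply: eq_in_reduced_span (@reduced_mono_in_span (a + b) a _ _); try lia.
  move=> y _; rewrite reduced_monoE; last lia.
  by rewrite leq_addr addKn.
- apply: eq_in_reduced_span
    (@reduced_mono_in_span (a + b).+1 (a + (a + b).+2) _ _); try lia.
  move=> y _; rewrite reduced_monoE; last lia.
  rewrite ifF; last lia.
  by congr (mono3 _ _ _ _); lia.
(* The square of the third coordinate is 1 minus the squares of the others. *)
have h a' b' : (a' + b' + e <= t)%N -> in_reduced_span (mono3 a' b' e).
  by apply: IH; lia.
have hs := in_reduced_spanD (h a b _) (in_reduced_spanZ (-1)
  (in_reduced_spanD (h a.+2 b _) (h a b.+2 _))).
apply: (eq_in_reduced_span _ (hs _ _ _)); try lia.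
move=> y /sphere_dot; rewrite /dot3 !big_ord_recl big_ord0 /mono3.
rewrite !exprS; move: (y _ _) (y _ _) (y _ _) => w v u uvw.
have ww : w * w = 1 - u * u - v * v by lra.
rewrite [RHS](_ : _ = u ^+ a * v ^+ b * w ^+ e * (w * w)); last by ring.
by rewrite ww; ring.
Qed.

Lemma meval_in_span (p : mpoly 3 R) : (msize p <= t.+1)%N ->
  in_reduced_span (fun y => meval (fun i => y i 0) p).
Proof.
move=> pt; have h : in_reduced_span (fun y =>
    \sum_(m : bmultinom 3 t.+1) mcoeff m p * mono3 (m i0) (m i1) (m i2) y).
  apply: in_reduced_span_sum => m; apply/in_reduced_spanZ/mono3_in_span.
  by have := bmdeg m; rewrite mdegE !big_ord_recl big_ord0 addn0 addnA.
apply: eq_in_reduced_span h => y _.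
rewrite [in RHS](mpolywE pt) raddf_sum; apply: eq_bigr => m _.
by rewrite /= mevalZ mevalX !big_ord_recl big_ord0 mulr1 /mono3 mulrA.
Qed.

Lemma sph_poly_in_span f : sph_poly t f -> in_reduced_span f.
Proof.
move=> [p pt fp]; apply: eq_in_reduced_span (meval_in_span pt) => y sy.
by rewrite fp.
Qed.

Lemma spherical_harmonic_sph_poly l f :
  (l <= t)%N -> spherical_harmonic l f -> sph_poly t f.
Proof.
move=> lt [p [hp _ fp]]; exists p => //.
rewrite msizeE; apply/bigmax_leqP_seq => m mp _.
by rewrite ltnS (dhomog_mf hp mp).
Qed.

Lemma sqrt_leq (j : 'I_N) : (Nat.sqrt j <= t)%N.
Proof.
have h := PeanoNat.Nat.sqrt_spec' j.
have jN : (j < t.+1 * t.+1)%N by rewrite mulnn ltn_ord.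
rewrite leqNgt; apply/negP => th.
have : (t.+1 * t.+1 <= Nat.sqrt j * Nat.sqrt j)%N by exact: leq_mul.
by lia.
Qed.

(** The harmonics of degree at most t are combinations of equally many monomials
    that span the spherical polynomials.  The matrix of the coefficients is a factor
    of the invertible matrix of values, so it can be inverted. *)
Lemma harmonics_span (Y : forall l : nat, 'I_(2 * l).+1 -> 'cV[R]_3 -> R)
    (X : 'I_N -> 'cV[R]_3) :
  (forall l k, spherical_harmonic l (Y l k)) -> (forall i, sphere (X i)) ->
  Ymx Y t X \in unitmx ->
  forall f, sph_poly t f -> exists c : 'cV[R]_N,
    forall n (X' : 'I_n -> 'cV[R]_3), (forall i, sphere (X' i)) ->
      forall i, f (X' i) = (Ymx Y t X' *m c) i 0.
Proof.
move=> hY sX Yu f ft.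
have spanY (j : 'I_N) :
    in_reduced_span (Y (Nat.sqrt j) (inord (j - Nat.sqrt j ^ 2))).
  exact/sph_poly_in_span/(spherical_harmonic_sph_poly (sqrt_leq j)).
have [d hd] := choice spanY.
pose G n (X' : 'I_n -> 'cV[R]_3) := \matrix_(i < n, j < N) reduced_mono j (X' i).
pose M := \matrix_(m < N, j < N) d j m 0.
have YG n (X' : 'I_n -> 'cV[R]_3) : (forall i, sphere (X' i)) ->
    Ymx Y t X' = G n X' *m M.
  move=> sX'; apply/matrixP => i j; rewrite !mxE hd //.
  by apply: eq_bigr => m _; rewrite !mxE.
have Mu : M \in unitmx by move: Yu; rewrite YG // unitmx_mul => /andP[].
have [c hc] := sph_poly_in_span ft.
exists (invmx M *m c) => n X' sX' i.
rewrite YG // -mulmxA mulKVmx // hc // mxE.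
by apply: eq_bigr => j _; rewrite mxE.
Qed.

End PolynomialSpan.

(** * Perturbation of linear systems *)

Section Perturbation.
Context {R : realType}.

Lemma mxnorm1_ge0 m n (A : 'M[R]_(m, n)) : 0 <= mxnorm1 A.
Proof. exact: bigmax_ge_id. Qed.

Lemma row_mul_le m n (u : 'rV[R]_m) (A : 'M[R]_(m, n)) (c s : R) j :
  0 <= c -> (forall i, `|u 0 i| <= c) -> \sum_i `|A i j| <= s ->
  `|(u *m A) 0 j| <= c * s.
Proof.
move=> c0 uc As; rewrite mxE; apply: (le_trans (ler_norm_sum _ _ _)).
apply: (@le_trans _ _ (c * \sum_i `|A i j|)); last exact: ler_wpM2l.
by rewrite mulr_sumr; apply: ler_sum => i _; rewrite normrM ler_wpM2r.
Qed.

Lemma row_mul_mxnorm1 m n (u : 'rV[R]_m) (A : 'M[R]_(m, n)) (c : R) j :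
  0 <= c -> (forall i, `|u 0 i| <= c) -> `|(u *m A) 0 j| <= c * mxnorm1 A.
Proof. by move=> c0 uc; apply: row_mul_le => //; exact: le_bigmax. Qed.

Lemma row_mul_entries m n (u : 'rV[R]_m) (A : 'M[R]_(m, n)) (c L : R) j :
  0 <= c -> (forall i, `|u 0 i| <= c) -> (forall i, `|A i j| <= L) ->
  `|(u *m A) 0 j| <= c * (m%:R * L).
Proof.
move=> c0 uc AL; apply: row_mul_le => //.
apply: (@le_trans _ _ (\sum_(i < m) L)); first exact: ler_sum.
by rewrite sumr_const card_ord mulr_natl.
Qed.

(** The fixed-point form of the Neumann series: u A = v reads
    u = v A0^-1 - u (A - A0) A0^-1, and the last term is at most q times the
    largest entry of u. *)
Lemma perturbed_solution_le n (A0 A : 'M[R]_n) (L : R) (u v : 'rV[R]_n) (g : R) :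
  A0 \in unitmx -> (forall i j, `|A i j - A0 i j| <= L) ->
  0 <= g -> n%:R * L * mxnorm1 (invmx A0) < 1 ->
  u *m A = v -> (forall j, `|(v *m invmx A0) 0 j| <= g) ->
  forall j, `|u 0 j| <= g / (1 - n%:R * L * mxnorm1 (invmx A0)).
Proof.
move=> A0u AL g0; set q := _ * mxnorm1 _ => q1 uA vg j.
pose mu := \big[Num.max/0]_(i < n) `|u 0 i|.
have mu0 : 0 <= mu by exact: bigmax_ge_id.
have u_mu i : `|u 0 i| <= mu by exact: le_bigmax.
have uE : u = v *m invmx A0 - u *m (A - A0) *m invmx A0.
  by rewrite -mulmxBl mulmxBr uA opprB addrC subrK mulmxK.
have nL0 : 0 <= n%:R * L.
  by rewrite mulr_ge0 //; exact: le_trans (normr_ge0 _) (AL j j).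
have q0 : 0 <= q by rewrite mulr_ge0 ?mxnorm1_ge0.
have u_le i : `|u 0 i| <= g + mu * q.
  have uDi k : `|(u *m (A - A0)) 0 k| <= mu * (n%:R * L).
    by apply: row_mul_entries => // k'; rewrite !mxE; exact: AL.
  have uDA := row_mul_mxnorm1 (invmx A0) i (mulr_ge0 mu0 nL0) uDi.
  rewrite -mulrA in uDA; have split_u := congr1 (fun r : 'rV_n => r 0 i) uE.
  rewrite /= [RHS]mxE [X in _ + X]mxE in split_u; rewrite split_u.
  by apply: (le_trans (ler_normB _ _)); apply: lerD.
have : mu <= g + mu * q.
  by apply: bigmax_le => [|i _]; [rewrite addr_ge0 // mulr_ge0 | exact: u_le].
move=> mu_le; apply: (le_trans (u_mu j)).
by rewrite ler_pdivlMr ?subr_gt0 // mulrBr mulr1 lerBlDr.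
Qed.

Lemma perturbed_unitmx n (A0 A : 'M[R]_n) (L : R) :
  A0 \in unitmx -> (forall i j, `|A i j - A0 i j| <= L) ->
  n%:R * L * mxnorm1 (invmx A0) < 1 -> A \in unitmx.
Proof.
move=> A0u AL q1; rewrite -row_free_unit; apply: inj_row_free => u uA.
apply/rowP => j; rewrite mxE; apply/eqP; rewrite -normr_le0.
have := perturbed_solution_le A0u AL (lexx 0) q1 uA; rewrite mul0r; apply.
by move=> i; rewrite mul0mx mxE normr0.
Qed.

End Perturbation.

(** * Point sets in spherical rectangles *)

(** Here q stands for tau * rad * kappa, and the hypothesis is the bound on the
    radius with its denominator cleared. *)
Lemma error_ratio_le (R : realFieldType) (q e : R) :
  0 <= q -> 0 <= e -> 2 * q + 4 * e * q < e ->
  [/\ 4 * q < 1, 2 * q / (1 - 4 * q) <= e & 2 * q / (1 - q) <= e].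
Proof.
move=> q0 e0 qe; have eq0 : 0 <= e * q by exact: mulr_ge0.
have q4 : 4 * q < 1.
  rewrite ltNge; apply/negP => hq.
  have : e * 1 <= e * (4 * q) by rewrite ler_wpM2l.
  by move: qe; rewrite -!mulrA mulrCA; lra.
split=> //; first by rewrite ler_pdivrMr ?subr_gt0 // mulrBr mulr1; lra.
by rewrite ler_pdivrMr ?subr_gt0; last lra; rewrite mulrBr mulr1; lra.
Qed.

Theorem corollary9 (R : realType)
    (Y : forall l : nat, 'I_(2 * l).+1 -> 'cV[R]_3 -> R)
    (hY : harmonic_basis Y)
    (t : nat) (ht : (1 <= t)%N)
    (Z : 'I_(t.+1 ^ 2) -> srect R) (eps : R) :
  let Xc := fun i => rect_center (Z i) in
  let tau : R := Num.sqrt ((2 * t%:R + 1) / (4 * pi)) * t.+1%:R ^+ 3 in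
  let kappa := mxnorm1 (invmx (Ymx Y t Xc)) in
  (exists X0, in_family X0 (fun i => rect_cap (Z i)) /\ t_design t X0) ->
  Ymx Y t Xc \in unitmx ->
  0 <= eps < 1 ->
  Zrad Z < Num.min (Zrho Z / 4) (eps / (2 * (1 + 2 * eps) * tau * kappa)) ->
  forall X : 'I_(t.+1 ^ 2) -> 'cV[R]_3,
    point_set X -> in_family X (fun i => rect_set (Z i)) ->
    [/\ fundamental t X, t_eps_design t eps X &
        2 * tau * Zrad Z * kappa / (1 - 4 * tau * Zrad Z * kappa) <= eps < 1].
Proof.
move=> Xc tau kappa [X0 [capX0 [[_ sX0] desX0]]] Yc_unit /andP[eps0 eps1].
rewrite lt_min => /andP[rad_rho rad_eps] X psX inX.
have [_ sX] := psX.
have sXc i : sphere (Xc i) by exact: spoint_sphere.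
have p0 := pi_gt0 R.
set r := Zrad Z in rad_rho rad_eps *.
have radius_le i : rect_radius (Z i) <= r by exact: le_bigmax.
have r0 : 0 <= r by exact: bigmax_ge_id.
have rho_le : Zrho Z <= pi by exact: bigmin_le_id.
have capX i : rect_cap (Z i) (X i).
  apply: rect_set_sub_cap (inX i).1.
  by apply: (le_lt_trans (radius_le i)); lra.
have tau0 : 0 < tau.
  have odd0 : 0 < 2 * t%:R + 1 :> R by rewrite -natrM natr1 ltr0n.
  by rewrite mulr_gt0 ?exprn_gt0 ?ltr0n // sqrtr_gt0 divr_gt0 // mulr_gt0.
have kappa0 : 0 < kappa.
  rewrite lt_neqAle mxnorm1_ge0 andbT; apply: contraTneq rad_eps => <-.
  by rewrite mulr0 invr0 mulr0 -leNgt.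
set q := tau * r * kappa.
have q0 : 0 <= q by rewrite !mulr_ge0 // ltW.
have q_eps : 2 * q + 4 * eps * q < eps.
  have e2 : 0 < 1 + 2 * eps by lra.
  have den0 := mulr_gt0 (mulr_gt0 (mulr_gt0 (ltr0Sn R 1) e2) tau0) kappa0.
  move: rad_eps; rewrite ltr_pdivlMr //.
  by apply: le_lt_trans; rewrite /q le_eqVlt; apply/orP; left; apply/eqP; ring.
have [q4 ratio4 ratio1] := error_ratio_le q0 eps0 q_eps.
set K : R := Num.sqrt ((2 * t%:R + 1) / (4 * pi)) * t.+1%:R.
have K0 : 0 <= K by rewrite mulr_ge0 ?sqrtr_ge0.
set N := (t.+1 ^ 2)%N; have N0 : (0 < N)%N by rewrite expn_gt0.
(* Each of the N entries of a column moves by at most K * r, and tau = N * K. *)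
have NK : N%:R * (K * r) * kappa = q.
  by rewrite /q /K /tau /N natrX; ring.
have entry (X' : 'I_N -> 'cV[R]_3) (i j : 'I_N) : rect_cap (Z i) (X' i) ->
    `|Ymx Y t X' i j - Ymx Y t Xc i j| <= K * r.
  move=> [sX' dX']; rewrite !mxE distrC.
  have f1 := hY.2 (Nat.sqrt j) (inord (j - Nat.sqrt j ^ 2))
    (Nat.sqrt j) (inord (j - Nat.sqrt j ^ 2)); rewrite !eqxx /= in f1.
  apply: le_trans (harmonic_lipschitz (sqrt_leq j) (hY.1 _ _) f1 (sXc i) sX') _.
  by rewrite ler_wpM2l // (le_trans dX').
have Y_near i j : `|Ymx Y t X i j - Ymx Y t Xc i j| <= K * r by exact: entry.
have Y_unit : Ymx Y t X \in unitmx.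
  by apply: perturbed_unitmx Yc_unit Y_near _; rewrite NK; lra.
have span := harmonics_span hY.1 sXc Yc_unit.
split; last by rewrite eps1 andbT; move: ratio4;
  rewrite /q -!mulrA; congr (_ <= _).
  move=> f /span[c hc] f0 x sx.
  have c0 : c = 0.
    rewrite -[c](mulKmx Y_unit); apply/matrixP => i j; rewrite (ord1 j) {j}.
    rewrite (_ : Ymx Y t X *m c = 0) ?mulmx0 //.
    by apply/matrixP => k j; rewrite (ord1 j) -hc // f0 mxE.
  by rewrite (hc 1%N (fun=> x) (fun=> sx) ord0) c0 mulmx0 mxE.
split=> //; set w0 : R := 4 * pi / N%:R.
have w00 : 0 < w0 by rewrite divr_gt0 ?mulr_gt0 ?ltr0n.
pose u0 : 'rV[R]_N := const_mx w0.
(* The weights that give, at the points X, the sums of the design X0. *)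
pose w := u0 *m Ymx Y t X0 *m invmx (Ymx Y t X).
have wY : w *m Ymx Y t X = u0 *m Ymx Y t X0 by rewrite mulmxKV.
exists w^T; split.
  have dw i : `|(w - u0) 0 i| <= w0 * eps.
    have u0E k : `|u0 0 k| <= w0 by rewrite mxE ger0_norm // ltW.
    have v_le j : `|(u0 *m (Ymx Y t X0 - Ymx Y t X) *m invmx (Ymx Y t Xc)) 0 j|
        <= w0 * (2 * q).
      rewrite (_ : w0 * (2 * q) = w0 * (N%:R * (2 * (K * r))) * kappa).
        apply: row_mul_mxnorm1 => [|k].
          by rewrite !mulr_ge0 // ltW.
        apply: row_mul_entries => // [|k']; first exact: ltW.
        rewrite mulr_natl mulr2n.
        rewrite !mxE -(subrKA (Y (Nat.sqrt k) (inord (k - Nat.sqrt k ^ 2)) (Xc k'))).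
        apply: (le_trans (ler_normD _ _)); apply: lerD.
          by have := entry X0 k' k (capX0 k').1; rewrite !mxE.
        by have := Y_near k' k; rewrite !mxE distrC.
      by rewrite -NK; ring.
    have uY : (w - u0) *m Ymx Y t X = u0 *m (Ymx Y t X0 - Ymx Y t X).
      by rewrite mulmxBl wY mulmxBr.
    have g0 : 0 <= w0 * (2 * q) by rewrite !mulr_ge0 // ltW.
    have q1 : N%:R * (K * r) * kappa < 1 by rewrite NK; lra.
    have := perturbed_solution_le Yc_unit Y_near g0 q1 uY v_le i.
    rewrite NK => /le_trans; apply.
    by rewrite -mulrA ler_wpM2l // ltW.
  move=> i; have := dw i; rewrite !mxE ler_norml => /andP[lo hi].
  apply/andP; split; first by rewrite mulrBr mulr1; lra.
  have e1 : 0 < 1 - eps by rewrite subr_gt0.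
  apply: (@le_trans _ _ (w0 * (1 + eps))); first by rewrite mulrDr mulr1; lra.
  (* (1 + eps) (1 - eps) <= 1 *)
  rewrite ler_pM2l // -[leRHS]mul1r ler_pdivlMr //.
  have := sqr_ge0 eps; rewrite expr2; lra.
move=> f ft; have [c hc] := span f ft.
have eval (v : 'rV[R]_N) (X' : 'I_N -> 'cV[R]_3) : (forall i, sphere (X' i)) ->
    \sum_(i < N) v 0 i * f (X' i) = (v *m Ymx Y t X' *m c) 0 0.
  by move=> sX'; rewrite -mulmxA mxE; apply: eq_bigr => i _; rewrite hc.
under eq_bigr do rewrite mxE.
rewrite eval // wY -eval //; under eq_bigr do rewrite mxE.
(* The design property turns the integral into the equal-weight sum over X0. *)
have := desX0 f ft; rewrite -mulr_sumr => /(congr1 ( *%R (4 * pi))).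
rewrite !mulrA divff ?mul1r //; last by rewrite mulf_neq0 ?gt_eqF.
Qed.
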